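(* For every choice of starting state, the expected number of steps required for the Pollard Rho algorithm for discrete logarithm on a cyclic group $G$ of odd order to have a collision is at most $$(1+o(1))\,12\sqrt{19}\,\sqrt{|G|}<(1+o(1))\,52.5\,\sqrt{|G|},$$ where $o(1)\to 0$ as $|G|\to\infty$. That is, for every $\varepsilon>0$ there is $N_0$ such that for every cyclic group $G$ of odd order $N\ge N_0$, every generator $g$ of $G$, every $h\in G$ and every starting element $y_0\in G$, the expected collision time satisfies $E[R]\le (1+\varepsilon)\,12\sqrt{19}\,\sqrt{N}$.
   Context: Let $G$ be a cyclic group with generator $g$ and let $h=g^x\in G$. The Pollard Rho algorithm is modelled as follows: each $y\in G$ is assigned independently and uniformly at random to one of three sets $S_1,S_2,S_3$. Define the iterating function $F:G\to G$ by $F(y)=gy$ if $y\in S_1$, $F(y)=hy$ if $y\in S_2$, and $F(y)=y^2$ if $y\in S_3$. Starting from $y_0$ the algorithm produces $y_{i+1}=F(y_i)$. A collision is the event that the walk passes over the same group element twice; the number of steps required for a collision is $R=\min\{n\ge 1: y_n\in\{y_0,\dots,y_{n-1}\}\}$, and the expectation is over the random partition. (Equivalently, until the first collision the exponents of $g$ evolve as the Markov chain on $\mathbb{Z}_N$ that moves from $u$ to $u+1$, $u+x$, $2u$ with probability $1/3$ each.) *)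

(* Defs.v *)
From HB Require Import structures.
From mathcomp Require Import all_boot all_order all_algebra all_fingroup all_solvable.
From mathcomp Require Import reals.

Set Implicit Arguments.
Unset Strict Implicit.
Unset Printing Implicit Defensive.

Import Order.TTheory GRing.Theory Num.Theory.
Local Open Scope ring_scope.

(* The values 0, 1, 2 of [s y] stand for y in S_1, S_2, S_3 respectively. *)
Definition rho_partition (G : finGroupType) := {ffun G -> 'I_3}.

Definition rho_step (G : finGroupType) (g h : G) (s : rho_partition G) (y : G)
    : G :=
  match val (s y) with
  | 0%N => (g * y)%g
  | 1%N => (h * y)%g
  | _ => (y ^+ 2)%g
  end.

(* [looping f y0 n] says that iter n f y0 is one of iter i f y0 with i < n. *)
Definition collides_at (T : finType) (f : T -> T) (y0 : T) : pred nat :=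
  fun n => (0 < n)%N && looping f y0 n.

Lemma ex_collides_at (T : finType) (f : T -> T) (y0 : T) :
  exists n, collides_at f y0 n.
Proof.
by exists (fingraph.order f y0); rewrite /collides_at fingraph.order_gt0 looping_order.
Qed.

Definition collision_time (T : finType) (f : T -> T) (y0 : T) : nat :=
  ex_minn (ex_collides_at f y0).

(* Choosing the class of every y independently and uniformly at random means
   that the partition is uniform on the finite type [rho_partition G], so that
   expectations are averages over this type. *)
Definition expected_collision_time (R : realType) (G : finGroupType)
    (g h y0 : G) : R :=
  (\sum_(s : rho_partition G) (collision_time (rho_step g h s) y0)%:R)
    / #|{: rho_partition G}|%:R.

(* Main.v *)
Require Import Defs.
From mathcomp Require Import all_boot all_order all_algebra all_fingroup all_solvable.
From mathcomp Require Import reals.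
From mathcomp Require Import ring lra zify.

Set Implicit Arguments.
Unset Strict Implicit.
Unset Printing Implicit Defensive.

Import Order.TTheory GRing.Theory Num.Theory.
Local Open Scope ring_scope.

(** Why the bound holds.  Let N be the order of the group.  Until its first
    repetition the walk reads the random partition at new points only, so it
    is the Markov chain that applies y -> gy, y -> hy or y -> y^2 with
    probability 1/3 each.  Hence the expected collision time is at most the
    sum over n of [survival n], the probability that n independent letters
    lead through n+1 distinct vertices ([expected_collision_time_le]).
    Survival is submultiplicative, so it is enough to bound it uniformly in
    the starting point at two times, l and 2l ([sum_survival]): bounds alpha
    and beta give the mean l (1 + alpha) / (1 - beta).  With l close to
    24 sqrt N the values alpha = 29/50 and beta = 13/50 are available for large
    N, and the mean is below 51.3 sqrt N + O(1), while 12 sqrt 19 is about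
    52.3.  This margin absorbs every error term.

    Survival is bounded by a second moment argument.  Let S count the pairs of
    times at distance at least 2T, up to time n, at which the walk is at the
    same vertex, where T is a mixing time.  Mixing gives E S ~ n^2 / (2N).  In
    E S^2 two pairs whose later times are more than T apart behave as if
    independent; pairs whose later times are closer contribute at most
    2 kappa n^2 / N, where kappa bounds the expected number of meetings, or of
    returns, within two windows of length T.  So the probability of S = 0 is at
    most 1 - (E S)^2 / E S^2, which is about 1 / (1 + n^2 / (8 kappa N))
    ([survival_second_moment]).

    Two facts about the chain remain.

    Mixing ([rho_mixes]): T of order (log N)^4 suffices.  The argument is in
    L^2.  If a round of about log N steps hardly decreases the norm of a
    function f of mean zero, then all three moves act on each iterate almost
    like the averaging operator.  Comparing y -> g^2 y^2 with y -> g y^2, both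
    of which are then close to two averaging steps, shows that f is almost
    invariant under translation by g; and squaring turns a translation by
    g^(2m) into one by g^m, so that binary expansion makes f almost invariant
    under all translations, hence almost equal to its mean.

    Correlations ([green_returns], [green_meets]): kappa = 90 + o(1).  Sort the
    words of length below T by their number k of squarings.  The kernel of the
    k-th layer has row and column sums at most 3, since each stretch between
    squarings has mean length 3 counting the final letter.  Its entries are at
    most 2 (2/3)^k as long as T 2^k <= N ([layer_le_geometric]): for a fixed
    exponent of h, the exponent of g in the final vertex determines the parity
    of the number of letters g after the last squaring, then of the number in
    the stretch before, and so on, and each parity costs a factor 2/3 on
    average.  Hence kappa is at most the sum over k and l of
    3 * 2 (2/3)^max(k,l), which is 90, up to the layers beyond log N. *)

(** * Random words and survival probabilities *)

Section Words.
Variables (R : realFieldType) (A V : finType) (st : A -> V -> V).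
Hypothesis A_gt0 : (0 < #|A|)%N.

Definition avg (phi : A -> R) : R := (\sum_a phi a) / #|A|%:R.

Lemma le_avg phi psi : (forall a, phi a <= psi a) -> avg phi <= avg psi.
Proof. by move=> le; rewrite ler_wpM2r ?invr_ge0 ?ler0n // ler_sum. Qed.

Lemma avgD phi psi : avg (fun a => phi a + psi a) = avg phi + avg psi.
Proof. by rewrite /avg big_split mulrDl. Qed.

Lemma avgZ c phi : avg (fun a => c * phi a) = c * avg phi.
Proof. by rewrite /avg -mulr_sumr mulrA. Qed.

Lemma avg_cst c : avg (fun=> c) = c.
Proof.
have -> : avg (fun=> c) = c * #|A|%:R / #|A|%:R.
  by rewrite /avg sumr_const mulr_natr.
by rewrite mulfK // pnatr_eq0 -lt0n.
Qed.

(** The expectation over n independent uniform letters, the head of a word being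
    its last letter: [drop d w] is then the word d steps earlier, and
    conditioning on the past is definitional. *)
Fixpoint expect n (F : seq A -> R) : R :=
  if n is n'.+1 then expect n' (fun w => avg (fun a => F (a :: w))) else F [::].

Lemma le_expect n F H :
  (forall w, size w = n -> F w <= H w) -> expect n F <= expect n H.
Proof.
elim: n F H => [|n IH] F H le /=; first exact: le.
by apply: IH => w sw; apply: le_avg => a; apply: le; rewrite /= sw.
Qed.

Lemma eq_expect n F H :
  (forall w, size w = n -> F w = H w) -> expect n F = expect n H.
Proof.
by move=> e; apply/eqP; rewrite eq_le !le_expect // => w /e->.
Qed.

Lemma expectD n F H : expect n (fun w => F w + H w) = expect n F + expect n H.
Proof.
elim: n F H => [|n IH] F H //=; rewrite -IH.
by apply: eq_expect => w _; rewrite avgD.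
Qed.

Lemma expectZ n c F : expect n (fun w => c * F w) = c * expect n F.
Proof.
elim: n F => [|n IH] F //=; rewrite -IH.
by apply: eq_expect => w _; rewrite avgZ.
Qed.

Lemma expect_cst n c : expect n (fun=> c) = c.
Proof.
elim: n => //= n IH; rewrite -[RHS]IH.
by apply: eq_expect => w _; rewrite avg_cst.
Qed.

Lemma expect_ge0 n F : (forall w, 0 <= F w) -> 0 <= expect n F.
Proof. by move=> F0; rewrite -(expect_cst n 0); apply: le_expect. Qed.

Lemma expect_sum n (I : Type) (r : seq I) (P : pred I) (F : I -> seq A -> R) :
  expect n (fun w => \sum_(i <- r | P i) F i w)
    = \sum_(i <- r | P i) expect n (F i).
Proof.
elim: r => [|i r IH].
  rewrite big_nil -[RHS](expect_cst n 0).
  by apply: eq_expect => w _; rewrite big_nil.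
rewrite big_cons -IH; case: (boolP (P i)) => Pi.
  by rewrite -expectD; apply: eq_expect => w _; rewrite big_cons Pi.
by apply: eq_expect => w _; rewrite big_cons (negbTE Pi).
Qed.

Lemma expect_cat n m F :
  expect (n + m) F = expect n (fun w => expect m (fun w' => F (w' ++ w))).
Proof.
elim: m F => [|m IH] F; first by rewrite addn0.
by rewrite addnS /= IH.
Qed.

Lemma expect_tail n m F : expect (n + m) (fun w => F (drop m w)) = expect n F.
Proof.
rewrite expect_cat; apply: eq_expect => w _.
rewrite -[RHS](expect_cst m); apply: eq_expect => w' sw'.
by rewrite drop_size_cat.
Qed.

Definition transfer (phi : V -> R) (v : V) : R := avg (fun a => phi (st a v)).

Definition endpoint (y : V) (w : seq A) : V := foldr st y w.

Lemma endpoint_cat y w w' :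
  endpoint y (w' ++ w) = endpoint (endpoint y w) w'.
Proof. exact: foldr_cat. Qed.

Lemma expect_endpoint n y phi :
  expect n (fun w => phi (endpoint y w)) = iter n transfer phi y.
Proof. by elim: n phi => // n IH phi; rewrite iterSr -IH. Qed.

(** The Markov property: given the word n letters long, the expectation of a
    function of the vertex d steps later is an iterate of the transfer operator. *)
Lemma expect_markov y n d (F : seq A -> V -> R) :
  expect (n + d) (fun w => F (drop d w) (endpoint y w))
    = expect n (fun w => iter d transfer (F w) (endpoint y w)).
Proof.
rewrite expect_cat; apply: eq_expect => w _.
rewrite -expect_endpoint; apply: eq_expect => w' sw'.
by rewrite drop_size_cat // endpoint_cat.
Qed.

Lemma le_transfer phi psi :
  (forall v, phi v <= psi v) -> forall v, transfer phi v <= transfer psi v.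
Proof. by move=> le v; apply: le_avg. Qed.

Lemma le_iter_transfer d phi psi :
  (forall v, phi v <= psi v) ->
  forall v, iter d transfer phi v <= iter d transfer psi v.
Proof. by move=> le; elim: d => //= d; apply: le_transfer. Qed.

Lemma eq_iter_transfer d phi psi :
  phi =1 psi -> iter d transfer phi =1 iter d transfer psi.
Proof.
by move=> e v; apply/eqP; rewrite eq_le !le_iter_transfer // => z; rewrite e.
Qed.

Lemma iter_transfer_cst d c v : iter d transfer (fun=> c) v = c.
Proof. by rewrite -expect_endpoint expect_cst. Qed.

Lemma iter_transfer_ge0 d phi :
  (forall v, 0 <= phi v) -> forall v, 0 <= iter d transfer phi v.
Proof.
by move=> p0 v; rewrite -(iter_transfer_cst d 0 v); apply: le_iter_transfer.
Qed.

Lemma iter_transferZ d c phi v :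
  iter d transfer (fun v => c * phi v) v = c * iter d transfer phi v.
Proof. by rewrite -!expect_endpoint -expectZ. Qed.

Lemma iter_transferD d phi psi v :
  iter d transfer (fun v => phi v + psi v) v
    = iter d transfer phi v + iter d transfer psi v.
Proof. by rewrite -!expect_endpoint -expectD. Qed.

Lemma iter_transfer_sum d (I : Type) (r : seq I) (P : pred I)
    (F : I -> V -> R) v :
  iter d transfer (fun v => \sum_(i <- r | P i) F i v) v
    = \sum_(i <- r | P i) iter d transfer (F i) v.
Proof.
rewrite -expect_endpoint expect_sum.
by apply: eq_bigr => i _; rewrite expect_endpoint.
Qed.

Definition dirac (v : V) (u : V) : R := (u == v)%:R.

Lemma dirac_ge0 v u : 0 <= dirac v u. Proof. exact: ler0n. Qed.

Lemma sum_dirac v : \sum_u dirac v u = 1.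
Proof.
rewrite (bigD1 v) //= /dirac eqxx big1 ?addr0 // => u /negbTE->.
by [].
Qed.

Lemma sum_dirac_mul phi v : \sum_u phi u * dirac u v = phi v.
Proof.
rewrite (bigD1 v) //= /dirac eqxx mulr1 big1 ?addr0 // => u.
by rewrite eq_sym => /negbTE->; rewrite mulr0.
Qed.

Lemma iter_transfer_kernel d phi u :
  iter d transfer phi u = \sum_v phi v * iter d transfer (dirac v) u.
Proof.
rewrite -(eq_iter_transfer _ (fun z => sum_dirac_mul phi z)).
by rewrite iter_transfer_sum; apply: eq_bigr => v _; rewrite iter_transferZ.
Qed.

Fixpoint visits (y : V) (w : seq A) : seq V :=
  if w is a :: w' then endpoint y w :: visits y w' else [:: y].

Lemma endpoint_visits y w : endpoint y w \in visits y w.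
Proof. by case: w => [|a w]; rewrite /= inE eqxx. Qed.

Lemma drop_visits y w d : endpoint y (drop d w) \in visits y w.
Proof.
elim: w d => [|a w IH] [|d]; rewrite ?drop0 ?endpoint_visits //.
by rewrite /= inE IH orbT.
Qed.

Lemma uniq_visits_neq y w d : uniq (visits y w) -> (0 < d <= size w)%N ->
  endpoint y (drop d w) != endpoint y w.
Proof.
case: w => [|a w] /=; first by case: d.
case: d => // d /andP[nin _] _ /=.
by apply: contraNneq nin => <-; apply: drop_visits.
Qed.

Lemma subseq_visits y w w' :
  subseq (visits (endpoint y w) w') (visits y (w' ++ w)).
Proof.
elim: w' => [|a w' IH]; last first.
  rewrite [visits _ (_ :: w')]/= [visits y _]/=.
  by rewrite -/(endpoint _ (a :: w' ++ w)) /= endpoint_cat eqxx.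
by rewrite /= sub1seq endpoint_visits.
Qed.

Lemma uniq_visits_tail y w w' :
  uniq (visits y (w' ++ w)) -> uniq (visits y w).
Proof. by elim: w' => //= a w' IH /andP[_ /IH]. Qed.

Definition survival n y := expect n (fun w => (uniq (visits y w))%:R).

Lemma survival_ge0 n y : 0 <= survival n y.
Proof. by apply: expect_ge0 => w; rewrite ler0n. Qed.

(** A walk with distinct vertices has distinct vertices on its first n steps and
    on its last m steps, and the latter are a fresh walk from a new start. *)
Lemma survivalD n m y beta : (forall v, survival m v <= beta) ->
  survival (n + m) y <= survival n y * beta.
Proof.
move=> le; rewrite /survival expect_cat mulrC -expectZ; apply: le_expect => w _.
case: (boolP (uniq (visits y w))) => uw; last first.
  rewrite mulr0 -(expect_cst m 0); apply: le_expect => w' _.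
  by case: (boolP (uniq _)) => // /uniq_visits_tail /idPn[].
rewrite mulr1; apply: le_trans (le (endpoint y w)); apply: le_expect => w' _.
case: (boolP (uniq (visits y _))) => [u|_]; last by rewrite ler0n.
by rewrite (subseq_uniq (subseq_visits y w w') u).
Qed.

Lemma survival_le1 n y : survival n y <= 1.
Proof.
rewrite -(expect_cst n 1); apply: le_expect => w _.
by rewrite -[1]/(1%:R) ler_nat leq_b1.
Qed.

Lemma le_survival n m y : (n <= m)%N -> survival m y <= survival n y.
Proof.
move=> /subnKC <-; rewrite -[leRHS]mulr1.
by apply: survivalD => v; apply: survival_le1.
Qed.

(** Cut time into periods of length 2L.  Each completed period costs a factor
    beta, and within a period survival is at most 1 on the first half and at
    most alpha on the second. *)
Lemma sum_survival L K y alpha beta : beta < 1 ->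
  (forall v, survival L v <= alpha) -> (forall v, survival (L + L) v <= beta) ->
  \sum_(0 <= n < K * (L + L)) survival n y <= L%:R * (1 + alpha) / (1 - beta).
Proof.
move=> b1 hL h2L.
have b0 : 0 <= beta by apply: le_trans (h2L y); apply: survival_ge0.
have a0 : 0 <= alpha by apply: le_trans (hL y); apply: survival_ge0.
rewrite ler_pdivlMr ?subr_gt0 //.
elim: K => [|K IH]; first by rewrite big_geq // mul0r mulr_ge0 ?ler0n // addr_ge0.
rewrite mulSn (big_cat_nat (n := L + L)) ?leq_addr //=.
rewrite (big_cat_nat (n := L)) ?leq_addr //=.
have h1 : \sum_(0 <= n < L) survival n y <= L%:R.
  rewrite -[X in _ <= X%:R]subn0 -sumr_const_nat; apply: ler_sum => i _.
  exact: survival_le1.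
have h2 : \sum_(L <= n < L + L) survival n y <= L%:R * alpha.
  rewrite -[X in _ <= X%:R * _](addnK L L) mulr_natl -sumr_const_nat.
  apply: ler_sum_nat => i /andP[Li _].
  exact: le_trans (le_survival y Li) (hL y).
have h3 : \sum_(L + L <= n < L + L + K * (L + L)) survival n y
    <= beta * \sum_(0 <= n < K * (L + L)) survival n y.
  rewrite -{1}[(L + L)%N]add0n big_addn addKn mulr_sumr.
  by apply: ler_sum => i _; rewrite mulrC; apply: survivalD.
set s := \sum_(0 <= n < K * (L + L)) _ in h3 IH.
have := IH; nra.
Qed.

End Words.

(** * Second moment of the number of returns *)

Section SecondMoment.
Variables (R : realFieldType) (A V : finType) (st : A -> V -> V).
Hypothesis A_gt0 : (0 < #|A|)%N.
Hypothesis st_inj : forall a, injective (st a).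
Variables (T : nat) (delta : R).
Hypothesis T_gt0 : (0 < T)%N.
Hypothesis delta_ge0 : 0 <= delta.
Notation N := (#|V|%:R : R).
Notation P := (transfer st : (V -> R) -> V -> R).
Notation E := (expect (A := A) (R := R)).

(** Tested on nonnegative functions, this says that every entry of the T-step
    kernel lies within a factor 1 - delta and 1 + delta of 1/N. *)
Definition mixes := forall phi u, (forall v, 0 <= phi v) ->
  (1 - delta) / N * \sum_v phi v <= iter T P phi u
    <= (1 + delta) / N * \sum_v phi v.

Hypothesis mixing : mixes.

Lemma mixes_leq d phi u : (T <= d)%N -> (forall v, 0 <= phi v) ->
  (1 - delta) / N * \sum_v phi v <= iter d P phi u
    <= (1 + delta) / N * \sum_v phi v.
Proof.
move=> /subnK <- phi0; rewrite iterD.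
rewrite -{1}(iter_transfer_cst st A_gt0 (d - T) ((1 - delta) / N * _) u).
rewrite -(iter_transfer_cst st A_gt0 (d - T) ((1 + delta) / N * _) u).
by apply/andP; split; apply: le_iter_transfer => v;
  case/andP: (mixing v phi0).
Qed.

Lemma sum_transfer phi : \sum_v P phi v = \sum_v phi v.
Proof.
rewrite /transfer /avg -mulr_suml exchange_big /=.
rewrite (eq_bigr (fun=> \sum_v phi v)) => [|a _]; last first.
  by rewrite [RHS](reindex_inj (@st_inj a)).
by rewrite -[LHS]/(avg (fun=> \sum_v phi v)) avg_cst.
Qed.

Lemma sum_iter_transfer d phi : \sum_v iter d P phi v = \sum_v phi v.
Proof. by elim: d => //= d IH; rewrite sum_transfer. Qed.

(** The truncated Green operator: [green (dirac v) u] is the expected number of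
    visits to v during the first T steps of the walk from u. *)
Definition green (phi : V -> R) (u : V) : R :=
  \sum_(0 <= e < T) iter e P phi u.

Lemma green_ge0 phi : (forall v, 0 <= phi v) -> forall u, 0 <= green phi u.
Proof. by move=> p0 u; apply: sumr_ge0 => e _; apply: iter_transfer_ge0. Qed.

Lemma sum_green_to u : \sum_v green (dirac R u) v = T%:R.
Proof.
rewrite /green exchange_big /=.
under eq_bigr => e _ do rewrite sum_iter_transfer sum_dirac.
by rewrite big_mkord sumr_const card_ord.
Qed.

Lemma sum_green_from u : \sum_v green (dirac R v) u = T%:R.
Proof.
rewrite /green exchange_big /=.
rewrite (eq_bigr (fun=> 1)) => [|e _]; last first.
  rewrite -(iter_transfer_cst st A_gt0 e 1 u) [RHS]iter_transfer_kernel //.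
  by apply: eq_bigr => v _; rewrite mul1r.
by rewrite big_mkord sumr_const card_ord.
Qed.

Variable kappa : R.
Hypothesis returns : forall u, green (green (dirac R u)) u <= kappa.
Hypothesis meets : forall u, green (fun v => green (dirac R v) u) u <= kappa.

Variable y : V.
Notation X := (endpoint st y).

(** The gap 2T leaves room for mixing between the two visits even when the later
    time is moved back by up to T, as happens in [expect_near]. *)
Definition returns_at n (w : seq A) : R :=
  \sum_(2 * T <= d < n.+1) dirac R (X (drop d w)) (X w).

Fixpoint return_count n (w : seq A) : R :=
  if n is n'.+1 then return_count n' (behead w) + returns_at n w else 0.

Notation Z := returns_at.
Notation S := return_count.

Lemma returns_at_ge0 n w : 0 <= Z n w.
Proof. by apply: sumr_ge0 => d _; apply: dirac_ge0. Qed.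

Lemma return_count_ge0 n w : 0 <= S n w.
Proof. by elim: n w => //= n IH w; rewrite addr_ge0 // returns_at_ge0. Qed.

(** Returns within fewer than 2T steps are not counted, so the count can vanish
    on a walk with repetitions: it bounds survival from above. *)
Lemma return_count_uniq w : uniq (visits st y w) -> S (size w) w = 0.
Proof.
elim: w => // a w IH uw; rewrite [LHS]/= IH; last by case/andP: uw.
rewrite add0r; apply: big1_seq => d /andP[_]; rewrite mem_index_iota => hd.
rewrite /dirac eq_sym (negbTE (uniq_visits_neq uw _)) //=.
by move: hd; lia.
Qed.

Lemma return_count_tail n e w : (e <= n)%N ->
  S n w = S (n - e) (drop e w) + \sum_(0 <= j < e) Z (n - j) (drop j w).
Proof.
elim: e => [|e IH] le; first by rewrite big_geq // addr0 subn0 drop0.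
rewrite IH; last exact: ltnW.
rewrite -(subnSK le) /= -drop1 drop_drop add1n -addrA; congr (_ + _).
by rewrite big_nat_recr //= addrC (subnSK le).
Qed.

Lemma expect_dirac n d : (d <= n)%N ->
  E n (fun w => dirac R (X (drop d w)) (X w))
    = E (n - d) (fun w => iter d P (dirac R (X w)) (X w)).
Proof.
move=> le.
by rewrite -(expect_markov st y _ _ (fun w => dirac R (X w))) subnK.
Qed.

Lemma expect_returns_at n :
  (1 - delta) / N * (n.+1 - 2 * T)%:R <= E n (Z n)
    <= (1 + delta) / N * (n.+1 - 2 * T)%:R.
Proof.
have bnd d w : (2 * T <= d)%N ->
    (1 - delta) / N <= iter d P (dirac R (X w)) (X w) <= (1 + delta) / N.
  move=> le; have Td : (T <= d)%N by lia.
  have := mixes_leq (X w) Td (@dirac_ge0 R V (X w)).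
  by rewrite sum_dirac !mulr1.
rewrite /Z expect_sum // !mulr_natr -!sumr_const_nat.
apply/andP; split; apply: ler_sum_nat => d /andP[le lt];
  rewrite expect_dirac //.
  rewrite -[leLHS](expect_cst A_gt0 (n - d)).
  by apply: le_expect => w _; case/andP: (bnd d w le).
rewrite -[leRHS](expect_cst A_gt0 (n - d)).
by apply: le_expect => w _; case/andP: (bnd d w le).
Qed.

Lemma expect_return_countS n :
  E n.+1 (S n.+1) = E n (S n) + E n.+1 (Z n.+1).
Proof.
rewrite -(expect_tail A_gt0 n 1 (S n)) addn1 -expectD.
by apply: eq_expect => w _ /=; rewrite drop1.
Qed.

Hypothesis delta_le1 : delta <= 1.

Lemma N_gt0 : 0 < N.
Proof. by rewrite ltr0n; apply/card_gt0P; exists y. Qed.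

Lemma ge_expect_return_count n :
  (1 - delta) * (n - 2 * T)%:R ^+ 2 / (2 * N) <= E n (S n).
Proof.
have N0 := N_gt0.
elim: n => [|n IH]; first by rewrite sub0n expr0n mulr0 mul0r expect_cst.
rewrite expect_return_countS.
have /andP[+ _] := expect_returns_at n.+1.
have [le|lt] := leqP (2 * T) n; last first.
  rewrite (_ : n.+1 - 2 * T = 0)%N; last by lia.
  rewrite expr0n mulr0 mul0r => h; apply: addr_ge0.
    by apply: expect_ge0 => // w; apply: return_count_ge0.
  by apply: expect_ge0 => // w; apply: returns_at_ge0.
move=> lb; apply: le_trans _ (lerD IH lb).
rewrite (_ : n.+2 - 2 * T = (n - 2 * T) + 2)%N; last by lia.
rewrite (_ : n.+1 - 2 * T = (n - 2 * T) + 1)%N; last by lia.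
rewrite !natrD; move: (n - 2 * T)%N => k.
rewrite -subr_ge0.
have -> : (1 - delta) * k%:R ^+ 2 / (2 * N) + (1 - delta) / N * (k%:R + 2%:R)
  - (1 - delta) * (k%:R + 1%:R) ^+ 2 / (2 * N) = (1 - delta) * (3 / (2 * N)).
  by field; rewrite gt_eqF.
by rewrite mulr_ge0 ?divr_ge0 ?subr_ge0 ?mulr_ge0 // ltW.
Qed.

Lemma le_expect_return_count n :
  E n (S n) <= (1 + delta) * n%:R ^+ 2 / (2 * N).
Proof.
have N0 := N_gt0.
elim: n => [|n IH]; first by rewrite expr0n mulr0 mul0r expect_cst.
rewrite expect_return_countS.
have /andP[_ ub] := expect_returns_at n.+1.
apply: le_trans (lerD IH ub) _.
have le : (n.+2 - 2 * T)%:R <= n%:R :> R by rewrite ler_nat; lia.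
apply: le_trans (lerD (lexx _) (ler_wpM2l _ le)) _.
  by rewrite divr_ge0 ?addr_ge0 // ltW.
rewrite -subr_ge0 -natr1.
have -> : (1 + delta) * (n%:R + 1) ^+ 2 / (2 * N) -
   ((1 + delta) * n%:R ^+ 2 / (2 * N) + (1 + delta) / N * n%:R)
  = (1 + delta) * (1 / (2 * N)).
  by field; rewrite gt_eqF.
by rewrite mulr_ge0 ?addr_ge0 ?divr_ge0 ?mulr_ge0 // ltW.
Qed.

(** All returns counted up to time n - T are known T steps before time n, so the
    vertex at time n is nearly uniform given them. *)
Lemma expect_far n : (T <= n)%N ->
  E n (fun w => S (n - T) (drop T w) * Z n w)
    <= (1 + delta) / N * (n.+1 - 2 * T)%:R * E (n - T) (S (n - T)).
Proof.
move=> Tn.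
pose F w' v := S (n - T) w' *
  \sum_(2 * T <= d < n.+1) dirac R (X (drop (d - T) w')) v.
have -> : E n (fun w => S (n - T) (drop T w) * Z n w)
    = E (n - T + T) (fun w => F (drop T w) (X w)).
  rewrite subnK //; apply: eq_expect => w _; congr (_ * _).
  apply: eq_big_nat => d /andP[le _].
  by rewrite drop_drop subnK //; lia.
rewrite expect_markov // -expectZ; apply: le_expect => w _.
have F0 v : 0 <= F w v.
  by rewrite mulr_ge0 ?return_count_ge0 // sumr_ge0.
have /andP[_ ub] := mixing (X w) F0; apply: le_trans ub _.
rewrite /F -mulr_sumr exchange_big /=.
rewrite (eq_bigr (fun=> 1)) => [|d _]; last by rewrite sum_dirac.
by rewrite sumr_const_nat mulrA mulrAC.
Qed.

Lemma sum_nat_shift m n (F : nat -> R) :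
  \sum_(m <= i < n) F i = \sum_(0 <= i < n - m) F (i + m)%N.
Proof. by rewrite -{1}[m]add0n big_addn. Qed.

(** The walk is nearly uniform at time n - j given its first n - 2T steps, so
    meeting the prescribed earlier vertex X_a costs a factor 1/N; from there it
    has j steps left to reach another earlier vertex X_b. *)
Lemma expect_near n j : (2 * T <= n)%N -> (j < T)%N ->
  E n (fun w => Z (n - j) (drop j w) * Z n w)
  <= (1 + delta) / N * E (n - 2 * T) (fun w =>
       \sum_(0 <= a < n.+1 - 2 * T) \sum_(0 <= b < n.+1 - 2 * T)
         iter j P (dirac R (X (drop b w))) (X (drop a w))).
Proof.
move=> len ltj.
set M := (n.+1 - 2 * T)%N; set g := (2 * T - j)%N.
pose F w' v := (\sum_(0 <= a < M) dirac R (X (drop a (drop g w'))) (X w'))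
  * \sum_(0 <= b < M) dirac R (X (drop b (drop g w'))) v.
pose H w v := (\sum_(0 <= a < M) dirac R (X (drop a w)) v)
  * \sum_(0 <= b < M) iter j P (dirac R (X (drop b w))) v.
have s1 : E n (fun w => Z (n - j) (drop j w) * Z n w)
    <= E (n - j + j) (fun w => F (drop j w) (X w)).
  rewrite subnK; last by lia.
  apply: le_expect => w _; apply: ler_pM; rewrite ?returns_at_ge0 //.
    (* the index d of the return at time n - j is shifted to a = d + j - 2T *)
    have [jM|Mj] := leqP j M; last first.
      rewrite /Z big_geq; last by move: Mj; rewrite /M; lia.
      by apply: sumr_ge0 => a _; apply: dirac_ge0.
    rewrite /Z [leRHS](big_cat_nat (n := j)) //=.
    apply: ler_wpDl; first by apply: sumr_ge0 => a _; apply: dirac_ge0.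
    rewrite [leLHS]sum_nat_shift [leRHS]sum_nat_shift.
    rewrite (_ : (n - j).+1 - 2 * T = M - j)%N; last by rewrite /M; lia.
    apply: ler_sum_nat => a _; rewrite !drop_drop.
    by have -> : (a + 2 * T + j = a + j + g + j)%N by rewrite /g; lia.
  rewrite /Z [leLHS]sum_nat_shift.
  apply: ler_sum_nat => a _; rewrite !drop_drop.
  by have -> : (a + g + j = a + 2 * T)%N by rewrite /g; lia.
apply: le_trans s1 _; rewrite expect_markov //.
have -> : E (n - j) (fun w => iter j P (F w) (X w))
    = E (n - 2 * T + g) (fun w => H (drop g w) (X w)).
  rewrite (_ : n - 2 * T + g = n - j)%N; last by rewrite /g; lia.
  apply: eq_expect => w _; rewrite /F iter_transferZ; congr (_ * _).
  exact: iter_transfer_sum.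
rewrite expect_markov // -expectZ; apply: le_expect => w _.
have H0 v : 0 <= H w v.
  by rewrite mulr_ge0 // sumr_ge0 // => d _;
    rewrite ?iter_transfer_ge0 // => *; apply: dirac_ge0.
have Tg : (T <= g)%N by rewrite /g; lia.
have /andP[_ ub] := mixes_leq (X w) Tg H0.
apply: le_trans ub _; rewrite /H.
under [X in _ * X <= _]eq_bigr => v _ do rewrite mulr_suml.
rewrite exchange_big /=.
rewrite le_eqVlt; apply/orP; left; apply/eqP; congr (_ * _).
apply: eq_bigr => a _; rewrite -[RHS](sum_dirac_mul (fun v =>
  \sum_(0 <= b < M) iter j P (dirac R (X (drop b w))) v) (X (drop a w))).
by apply: eq_bigr => v _; rewrite mulrC /dirac eq_sym.
Qed.

Lemma sum_square_le (K : nat -> nat -> R) M : (forall a b, 0 <= K a b) ->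
  \sum_(0 <= a < M) \sum_(0 <= b < M) K a b
  <= \sum_(0 <= b < M) \sum_(0 <= a < b.+1) K a b
     + \sum_(0 <= a < M) \sum_(0 <= b < a.+1) K a b.
Proof.
move=> K0; elim: M => [|M IH]; first by rewrite !big_geq // addr0.
have e : \sum_(0 <= a < M) \sum_(0 <= b < M.+1) K a b
    = \sum_(0 <= a < M) \sum_(0 <= b < M) K a b + \sum_(0 <= a < M) K a M.
  by rewrite -big_split; apply: eq_bigr => a _; rewrite big_nat_recr.
rewrite !(@big_nat_recr _ _ _ M 0) //= e.
have := K0 M M; lra.
Qed.

(** Only the segment of the walk between the two times matters: it starts afresh
    at the earlier vertex. *)
Lemma expect_pair (L : V -> V -> R) m a b : (a <= b <= m)%N ->
  E m (fun w => L (X (drop b w)) (X (drop a w)))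
    = E (m - b) (fun w => iter (b - a) P (L (X w)) (X w)).
Proof.
move=> /andP[ab bm].
transitivity (E (m - a) (fun w => L (X (drop (b - a) w)) (X w))).
  rewrite -[RHS](expect_tail A_gt0 _ a) subnK; last exact: leq_trans ab bm.
  by apply: eq_expect => w _; rewrite drop_drop subnK.
rewrite -(expect_markov st y _ _ (fun w => L (X w))).
by congr (expect _ _); lia.
Qed.

(** Up to time T the sum is a Green function, controlled by kappa; after time T
    each term is nearly its stationary value T / N. *)
Lemma sum_correlations (L : V -> V -> R) u B :
  (forall v, 0 <= L u v) -> \sum_v L u v = T%:R ->
  green (L u) u <= kappa ->
  \sum_(0 <= c < B) iter c P (L u) u <= kappa + (1 + delta) / N * T%:R * B%:R.
Proof.
move=> L0 sL gL.
have N0 := N_gt0.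
apply: (@le_trans _ _ (\sum_(0 <= c < T + B) iter c P (L u) u)).
  rewrite [leRHS](big_cat_nat (n := B)) ?leq_addl //= lerDl.
  by apply: sumr_ge0 => c _; apply: iter_transfer_ge0.
rewrite (big_cat_nat (n := T)) ?leq_addr //=; apply: lerD => //.
rewrite mulr_natr -[X in _ *+ X](addKn T) -sumr_const_nat.
apply: ler_sum_nat => c /andP[Tc _].
by have /andP[_] := mixes_leq u Tc L0; rewrite sL.
Qed.

Lemma expect_correlations (L : V -> V -> R) m M Q :
  (forall u v, 0 <= L u v) -> (forall u, \sum_v L u v = T%:R) ->
  (forall u, green (L u) u <= kappa) -> (M <= m.+1)%N -> (M <= Q)%N ->
  \sum_(0 <= b < M) \sum_(0 <= a < b.+1)
     E m (fun w => L (X (drop b w)) (X (drop a w)))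
  <= M%:R * (kappa + (1 + delta) / N * T%:R * Q%:R).
Proof.
move=> L0 sL gL Mm MQ; have N0 := N_gt0.
rewrite mulr_natl -[X in _ *+ X]subn0 -sumr_const_nat.
apply: ler_sum_nat => b /andP[_ bM].
have bm : (b <= m)%N by lia.
rewrite (_ : \sum_(0 <= a < b.+1) _ = E (m - b) (fun w =>
    \sum_(0 <= c < b.+1) iter c P (L (X w)) (X w))); last first.
  rewrite expect_sum // big_nat_rev /=; apply: eq_big_nat => c /andP[_ cb].
  rewrite expect_pair ?add0n ?subSS; last by lia.
  by rewrite subKn //; lia.
rewrite -[leRHS](expect_cst A_gt0 (m - b)); apply: le_expect => w _.
apply: le_trans (sum_correlations _ (L0 (X w)) (sL _) (gL _)) _.
rewrite lerD2l ler_wpM2l ?ler_nat; last by lia.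
  by [].
by rewrite mulr_ge0 ?ler0n // divr_ge0 ?addr_ge0 // ltW.
Qed.

Definition near_bound Q : R := 2 * (kappa + (1 + delta) / N * T%:R * Q%:R).

Lemma kappa_ge0 : 0 <= kappa.
Proof.
apply: le_trans (returns y); apply: green_ge0 => v.
by apply: green_ge0 => u; apply: dirac_ge0.
Qed.

Lemma near_bound_ge0 Q : 0 <= near_bound Q.
Proof.
have N0 := N_gt0; have k0 := kappa_ge0.
rewrite /near_bound mulr_ge0 //; apply: addr_ge0 => //.
by rewrite !mulr_ge0 ?invr_ge0 ?addr_ge0 // ltW.
Qed.

(** Summing [expect_near] over j < T leaves the Green function between all pairs
    of vertices of the past.  If X_a is the earlier of the two, these count meetings
    of two independent walks from X_a, otherwise returns to X_b; both are covered
    by [expect_correlations]. *)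
Lemma expect_all_near n Q : (2 * T <= n)%N -> (n <= Q)%N ->
  \sum_(0 <= j < T) E n (fun w => Z (n - j) (drop j w) * Z n w)
  <= (1 + delta) / N * ((n.+1 - 2 * T)%:R * near_bound Q).
Proof.
move=> le nQ; have N0 := N_gt0; set M := (n.+1 - 2 * T)%N.
pose K w a b := green (dirac R (X (drop b w))) (X (drop a w)).
have K0 w a b : 0 <= K w a b by apply: green_ge0 => u; apply: dirac_ge0.
apply: (@le_trans _ _ ((1 + delta) / N * E (n - 2 * T) (fun w =>
    \sum_(0 <= a < M) \sum_(0 <= b < M) K w a b))).
  apply: (@le_trans _ _ (\sum_(0 <= j < T) (1 + delta) / N * E (n - 2 * T)
      (fun w => \sum_(0 <= a < M) \sum_(0 <= b < M)
        iter j P (dirac R (X (drop b w))) (X (drop a w))))).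
    by apply: ler_sum_nat => j /andP[_ jT]; apply: expect_near.
  rewrite -mulr_sumr -expect_sum // le_eqVlt; apply/orP; left; apply/eqP.
  congr (_ * _); apply: eq_expect => w _; rewrite exchange_big /=.
  by apply: eq_bigr => a _; rewrite exchange_big.
rewrite ler_wpM2l //; first by rewrite divr_ge0 ?addr_ge0 // ltW.
apply: le_trans (le_expect (fun w _ => sum_square_le M (K0 w))) _.
rewrite expectD !expect_sum //.
under eq_bigr => b _ do rewrite expect_sum //.
under [X in _ + X]eq_bigr => a _ do rewrite expect_sum //.
have gd v u : 0 <= green (dirac R v) u.
  by apply: green_ge0 => z; apply: dirac_ge0.
apply: le_trans (lerD
  (@expect_correlations (fun u v => green (dirac R u) v) (n - 2 * T) M Q
     gd sum_green_to returns _ _)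
  (@expect_correlations (fun u v => green (dirac R v) u) (n - 2 * T) M Q
     (fun u v => gd v u) sum_green_from meets _ _)) _; rewrite /M; try lia.
rewrite /near_bound; lra.
Qed.

Lemma expect_return_count_returns n Q : (n < Q)%N ->
  E n.+1 (fun w => S n.+1 w * Z n.+1 w)
  <= (1 + delta) / N * n%:R
     * ((1 + delta) * n%:R ^+ 2 / (2 * N) + near_bound Q).
Proof.
move=> nQ; have N0 := N_gt0; have B0 := near_bound_ge0 Q.
have d1 : 0 <= 1 + delta by rewrite addr_ge0.
have dN : 0 <= (1 + delta) / N by rewrite divr_ge0 // ltW.
have [lt|le] := ltnP n.+1 (2 * T).
  apply: (@le_trans _ _ 0); last first.
    apply: mulr_ge0; first exact: mulr_ge0.
    apply: addr_ge0 => //; apply: divr_ge0; last by rewrite mulr_ge0 // ltW.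
    by rewrite mulr_ge0 ?sqr_ge0.
  rewrite -(expect_cst A_gt0 n.+1 0); apply: le_expect => w _.
  by rewrite /Z big_geq ?mulr0.
have Tn : (T <= n.+1)%N by lia.
have cn : (n.+2 - 2 * T)%:R <= n%:R :> R by rewrite ler_nat; lia.
have -> : E n.+1 (fun w => S n.+1 w * Z n.+1 w)
   = E n.+1 (fun w => S (n.+1 - T) (drop T w) * Z n.+1 w)
     + \sum_(0 <= j < T) E n.+1 (fun w => Z (n.+1 - j) (drop j w) * Z n.+1 w).
  rewrite -expect_sum // -expectD; apply: eq_expect => w _.
  by rewrite (return_count_tail w Tn) mulrDl mulr_suml.
apply: le_trans (lerD (expect_far Tn) (expect_all_near le nQ)) _.
rewrite -mulrA -mulrDr -mulrDr -mulrA ler_wpM2l //.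
apply: ler_pM => //.
  apply: addr_ge0 => //; apply: expect_ge0 => // w; exact: return_count_ge0.
rewrite lerD2r; apply: le_trans (le_expect_return_count _) _.
apply: ler_wpM2r; first by rewrite invr_ge0 mulr_ge0 // ltW.
apply: ler_wpM2l => //; by rewrite lerXn2r ?nnegrE ?ler0n // ler_nat; lia.
Qed.

Definition second_moment_bound n : R :=
  (1 + delta) ^+ 2 * n%:R ^+ 4 / (4 * N ^+ 2)
  + (1 + delta) * n%:R ^+ 2 * near_bound n / N.

(** In S_k^2 = (S_(k-1) + Z_k)^2 the increment is at most 2 S_k Z_k, and the
    increments of n^4 / 4 and n^2 dominate n^3 and 2n. *)
Lemma le_expect_return_count_sqr n :
  E n (fun w => S n w ^+ 2) <= second_moment_bound n.
Proof.
have N0 := N_gt0; have B0 := near_bound_ge0 n.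
have d1 : 0 <= 1 + delta by rewrite addr_ge0.
suff H k : (k <= n)%N -> E k (fun w => S k w ^+ 2)
    <= (1 + delta) ^+ 2 * k%:R ^+ 4 / (4 * N ^+ 2)
       + (1 + delta) * k%:R ^+ 2 * near_bound n / N by exact: H.
elim: k => [|k IH] kn.
  by rewrite /= expr0n !expr0n !mulr0 !mul0r addr0.
have step : E k.+1 (fun w => S k.+1 w ^+ 2)
    <= E k (fun w => S k w ^+ 2) + 2 * E k.+1 (fun w => S k.+1 w * Z k.+1 w).
  rewrite -(expect_tail A_gt0 k 1 (fun w => S k w ^+ 2)) addn1.
  rewrite -expectZ -expectD; apply: le_expect => // w _.
  rewrite [S k.+1 w]/= drop1.
  by have := sqr_ge0 (Z k.+1 w); nra.
apply: le_trans step _.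
apply: le_trans (lerD (IH (ltnW kn))
  (ler_wpM2l _ (expect_return_count_returns kn))) _ => //.
rewrite -(natr1 k) -subr_ge0; move: (near_bound n) B0 => B B0.
set x : R := k%:R; have x0 : 0 <= x by rewrite ler0n.
have -> : (1 + delta) ^+ 2 * (x + 1) ^+ 4 / (4 * N ^+ 2) +
     (1 + delta) * (x + 1) ^+ 2 * B / N -
     ((1 + delta) ^+ 2 * x ^+ 4 / (4 * N ^+ 2) + (1 + delta) * x ^+ 2 * B / N +
      2 * ((1 + delta) / N * x * ((1 + delta) * x ^+ 2 / (2 * N) + B)))
  = (1 + delta) ^+ 2 * (6 * x ^+ 2 + 4 * x + 1) / (4 * N ^+ 2)
    + (1 + delta) * B / N.
  by field; rewrite gt_eqF.
apply: addr_ge0; last by rewrite divr_ge0 ?mulr_ge0 // ltW.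
apply: divr_ge0; last by rewrite mulr_ge0 ?sqr_ge0.
by rewrite mulr_ge0 ?sqr_ge0 // !addr_ge0 ?mulr_ge0 ?sqr_ge0.
Qed.

(** For every lambda the indicator of S = 0 is at most (1 - lambda S)^2; the
    optimal lambda is E S / E S^2, here with bounds in place of the moments. *)
Lemma survival_second_moment n : (0 < n)%N ->
  survival R st n y <=
  1 - ((1 - delta) * (n - 2 * T)%:R ^+ 2 / (2 * N)) ^+ 2
      / second_moment_bound n.
Proof.
move=> n0; have N0 := N_gt0; have B0 := near_bound_ge0 n.
set m := (_ / (2 * N)); set W := second_moment_bound n.
have m0 : 0 <= m.
  by rewrite divr_ge0 ?mulr_ge0 ?sqr_ge0 ?subr_ge0 // ltW.
have W0 : 0 < W.
  have d1 : 0 < 1 + delta by rewrite ltr_wpDr.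
  apply: ltr_wpDr.
    apply: divr_ge0; last exact: ltW.
    by apply: mulr_ge0 => //; apply: mulr_ge0; rewrite ?sqr_ge0 // ltW.
  by apply: divr_gt0; apply: mulr_gt0; rewrite ?exprn_gt0 // ltr0n.
(* the minimiser of 1 - 2 lam m + lam^2 W *)
set lam := m / W; have lam0 : 0 <= lam by rewrite divr_ge0 // ltW.
apply: (@le_trans _ _ (E n (fun w => (1 - lam * S n w) ^+ 2))).
  apply: le_expect => // w sw; case: (boolP (uniq _)) => [u|_].
    by rewrite -sw return_count_uniq // mulr0 subr0 expr1n.
  exact: sqr_ge0.
have -> : E n (fun w => (1 - lam * S n w) ^+ 2)
   = 1 + (- 2 * lam) * E n (S n) + lam ^+ 2 * E n (fun w => S n w ^+ 2).
  rewrite -!expectZ -[X in X + _ + _](expect_cst A_gt0 n) -!expectD.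
  by apply: eq_expect => w _; ring.
have h1 := ge_expect_return_count n; rewrite -/m in h1.
have h2 := le_expect_return_count_sqr n; rewrite -/W in h2.
have -> : m ^+ 2 / W = 2 * lam * m - lam ^+ 2 * W.
  by rewrite /lam; field; rewrite gt_eqF.
have := ler_wpM2l lam0 h1; have := ler_wpM2l (sqr_ge0 lam) h2.
lra.
Qed.

End SecondMoment.

(** * Mixing of the rho walk by L^2 contraction *)

Section SquareNorm.
Variables (R : realFieldType) (V : finType).
Implicit Types f v w : V -> R.

Definition sqnorm f : R := \sum_y f y ^+ 2.

Lemma sqnorm_ge0 f : 0 <= sqnorm f.
Proof. by apply: sumr_ge0 => y _; apply: sqr_ge0. Qed.

Lemma eq_sqnorm f f' : f =1 f' -> sqnorm f = sqnorm f'.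
Proof. by move=> e; apply: eq_bigr => y _; rewrite e. Qed.

Lemma sqnorm_comp (s : V -> V) f : injective s ->
  sqnorm (fun y => f (s y)) = sqnorm f.
Proof. by move=> s_inj; rewrite [RHS](reindex_inj s_inj). Qed.

Lemma sqr_le_sqnorm f y : f y ^+ 2 <= sqnorm f.
Proof.
rewrite /sqnorm (bigD1 y) //= lerDl.
by apply: sumr_ge0 => z _; apply: sqr_ge0.
Qed.

(** The L^2 norm of f is at most n times the square root of c.  Natural multiples
    of a fixed unit make the triangle inequality additive without square roots. *)
Definition norm_le (c : R) (n : nat) f := sqnorm f <= n%:R ^+ 2 * c.

Lemma eq_norm_le c n f f' : f =1 f' -> norm_le c n f -> norm_le c n f'.
Proof. by move=> e; rewrite /norm_le (eq_sqnorm e). Qed.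

Lemma norm_le_comp c n (s : V -> V) f : injective s ->
  norm_le c n (fun y => f (s y)) <-> norm_le c n f.
Proof. by move=> s_inj; rewrite /norm_le sqnorm_comp. Qed.

Lemma norm_leN c n f : norm_le c n f -> norm_le c n (fun y => - f y).
Proof. by rewrite /norm_le /sqnorm; under eq_bigr do rewrite -sqrrN. Qed.

Lemma norm_le0 c f : norm_le c 0 f -> f =1 (fun=> 0).
Proof.
rewrite /norm_le expr0n mul0r => le y; apply/eqP.
by rewrite -sqrf_eq0 eq_le sqr_ge0 (le_trans (sqr_le_sqnorm f y) le).
Qed.

(** With a = n and b = m, convexity gives
    a b (x + y)^2 <= (a + b) (b x^2 + a y^2), which is the triangle inequality
    between norms a and b after summation. *)
Lemma norm_leD c n m f f' : norm_le c n f -> norm_le c m f' ->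
  norm_le c (n + m) (fun y => f y + f' y).
Proof.
move=> hf hf'; case: n hf => [/norm_le0 e|n hf].
  by apply: eq_norm_le hf' => y; rewrite e add0r.
case: m hf' => [/norm_le0 e|m hf'].
  by rewrite addn0; apply: eq_norm_le hf => y; rewrite e addr0.
rewrite /norm_le natrD; set a : R := n.+1%:R; set b : R := m.+1%:R.
have a0 : 0 < a by rewrite ltr0n.
have b0 : 0 < b by rewrite ltr0n.
have h : a * b * sqnorm (fun y => f y + f' y)
    <= (a + b) * (b * sqnorm f + a * sqnorm f').
  rewrite /sqnorm !mulr_sumr -big_split mulr_sumr /=; apply: ler_sum => y _.
  by have := sqr_ge0 (b * f y - a * f' y); nra.
rewrite -(ler_pM2l (mulr_gt0 a0 b0)); apply: le_trans h _.
rewrite -/a -/b in hf hf' *; rewrite /norm_le in hf hf'.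
have -> : a * b * ((a + b) ^+ 2 * c)
  = (a + b) * (b * (a ^+ 2 * c) + a * (b ^+ 2 * c)) by ring.
rewrite ler_pM2l ?addr_gt0 //; apply: lerD; rewrite ler_pM2l //.
Qed.

Lemma norm_leB c n m f f' : norm_le c n f -> norm_le c m f' ->
  norm_le c (n + m) (fun y => f y - f' y).
Proof. by move=> hf /norm_leN; apply: norm_leD. Qed.

Lemma norm_le_sum c n k (F : nat -> V -> R) :
  (forall i, (i < k)%N -> norm_le c n (F i)) ->
  norm_le c (k * n) (fun y => \sum_(0 <= i < k) F i y).
Proof.
elim: k => [|k IH] hF.
  rewrite /norm_le /sqnorm big1 ?mul0n ?expr0n ?mul0r // => y _.
  by rewrite big_geq // expr0n.
rewrite mulSn addnC.
apply: (eq_norm_le (f := fun y => \sum_(0 <= i < k) F i y + F k y)) => [y|].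
  by rewrite big_nat_recr.
by apply: norm_leD; [apply: IH => i ik; apply: hF; apply: ltnW | apply: hF].
Qed.

End SquareNorm.

Section Variance.
Variables (R : realFieldType) (A V : finType) (st : A -> V -> V).
Hypothesis A_gt0 : (0 < #|A|)%N.
Hypothesis st_inj : forall a, injective (st a).
Notation P := (transfer (R := R) st).

(** The variance identity: the moves preserve the norm, and their average loses
    exactly their variance around it. *)
Lemma sum_sqnorm_step f :
  \sum_a sqnorm (fun y => f (st a y) - P f y)
    = #|A|%:R * (sqnorm f - sqnorm (P f)).
Proof.
have A0 : #|A|%:R != 0 :> R by rewrite pnatr_eq0 -lt0n.
have e y : \sum_a f (st a y) = #|A|%:R * P f y.
  by rewrite /transfer /avg mulrCA mulfV // mulr1.
have e2 : \sum_a \sum_y f (st a y) ^+ 2 = #|A|%:R * sqnorm f.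
  rewrite (eq_bigr (fun=> sqnorm f)) => [|a _].
    by rewrite sumr_const mulr_natl.
  exact: sqnorm_comp.
rewrite mulrBr -e2 /sqnorm exchange_big [X in _ = X - _]exchange_big /=.
rewrite mulr_sumr -sumrB; apply: eq_bigr => y _.
rewrite (eq_bigr (fun a => f (st a y) ^+ 2
  + ((- 2 * P f y) * f (st a y) + P f y ^+ 2))) => [|a _]; last by ring.
rewrite big_split big_split /= -mulr_sumr e sumr_const -[_ *+ _]mulr_natl.
rewrite -[#|_|]/#|A|; ring.
Qed.

Lemma sqnorm_step_le f a :
  sqnorm (fun y => f (st a y) - P f y)
    <= #|A|%:R * (sqnorm f - sqnorm (P f)).
Proof.
rewrite -sum_sqnorm_step (bigD1 a) //= lerDl.
by apply: sumr_ge0 => b _; apply: sqnorm_ge0.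
Qed.

Lemma le_sqnorm_transfer f : sqnorm (P f) <= sqnorm f.
Proof.
rewrite -subr_ge0 -(@pmulr_rge0 _ #|A|%:R) ?ltr0n //.
by rewrite -sum_sqnorm_step sumr_ge0 // => a _; apply: sqnorm_ge0.
Qed.

Lemma le_sqnorm_iter s t f : (s <= t)%N ->
  sqnorm (iter t P f) <= sqnorm (iter s P f).
Proof.
elim: t => [|t IH]; first by rewrite leqn0 => /eqP->.
rewrite leq_eqVlt => /orP[/eqP->//|/IH]; apply: le_trans.
exact: le_sqnorm_transfer.
Qed.

End Variance.

Lemma half_power_bound (R : realFieldType) (K : nat) : (0 < K)%N ->
  (1 - K%:R^-1) ^+ K <= 2^-1 :> R.
Proof.
move=> K0; have k0 : 0 < K%:R :> R by rewrite ltr0n.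
have k1 : 1 <= K%:R :> R by rewrite ler1n.
have i0 : 0 <= K%:R^-1 :> R by rewrite invr_ge0 ltW.
have i1 : 0 <= 1 - K%:R^-1 :> R by rewrite subr_ge0 invf_le1.
have bern n : 1 + n%:R * K%:R^-1 <= (1 + K%:R^-1) ^+ n :> R.
  elim: n => [|n IH]; first by rewrite mul0r addr0 expr0.
  rewrite exprS; have := ler_wpM2l (addr_ge0 ler01 i0) IH.
  apply: le_trans; rewrite -natr1.
  have : 0 <= n%:R * K%:R^-1 * K%:R^-1 :> R by rewrite !mulr_ge0.
  nra.
have b := bern K; rewrite mulfV ?gt_eqF // in b.
have p : ((1 - K%:R^-1) * (1 + K%:R^-1)) ^+ K <= 1 :> R.
  apply: exprn_ile1; first by apply: mulr_ge0 => //; apply: addr_ge0.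
  by have := sqr_ge0 (K%:R^-1 : R); nra.
rewrite exprMn in p.
have := exprn_ge0 K i1; nra.
Qed.

Section RhoMap.
Variables (gT : finGroupType) (g h : gT).

Definition rho_map (c : 'I_3) (y : gT) : gT :=
  match val c with
  | 0%N => (g * y)%g
  | 1%N => (h * y)%g
  | _ => (y ^+ 2)%g
  end.

(** In a group of odd order N the inverse of squaring is the power (N + 1) / 2. *)
Lemma sqr_inj_odd : odd #|gT| -> injective (fun y : gT => (y ^+ 2)%g).
Proof.
move=> oN; apply: (can_inj (g := fun z => (z ^+ (#|gT|.+1)./2)%g)) => y.
rewrite -expgM mul2n halfK /= oN /= subn0 expgS.
by rewrite -cardsT expg_cardG ?inE // mulg1.
Qed.

Lemma rho_map_inj c : odd #|gT| -> injective (rho_map c).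
Proof.
move=> oN; rewrite /rho_map; case: (val c) => [|[|_]].
- exact: mulgI.
- exact: mulgI.
- exact: sqr_inj_odd.
Qed.

End RhoMap.

Section Mixing.
Variables (R : realFieldType) (gT : finGroupType) (g h : gT).
Hypothesis odd_G : odd #|gT|.
Hypothesis gen_g : generator [set: gT] g.
Notation P := (transfer (R := R) (rho_map g h)).
Notation N := (#|gT|%:R : R).

Lemma generator_mulC (x y : gT) : (x * y = y * x)%g.
Proof.
have /eqP e := gen_g.
have /cycleP[i ->] : x \in <[g]>%g by rewrite -e inE.
have /cycleP[j ->] : y \in <[g]>%g by rewrite -e inE.
by rewrite -!expgD addnC.
Qed.

Lemma order_generator : #[g]%g = #|gT|.
Proof. by rewrite /order -(eqP gen_g) cardsT. Qed.

(** Translates by all powers of the generator average a function over the group. *)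
Lemma sum_generator (f : gT -> R) y :
  \sum_(0 <= m < #|gT|) f (g ^+ m * y)%g = \sum_z f z.
Proof.
rewrite big_mkord.
pose F (m : 'I_#|gT|) := (g ^+ m * y)%g.
have F_inj : injective F.
  move=> i j /mulIg /eqP; rewrite eq_expg_mod_order order_generator.
  by rewrite !modn_small // => /eqP/val_inj.
have F_bij : bijective F by apply: inj_card_bij; rewrite ?card_ord.
by rewrite [RHS](reindex F) //; apply: onW_bij.
Qed.

Let st_inj := fun c => @rho_map_inj gT g h c odd_G.
Let A_gt0 : (0 < #|'I_3|)%N. Proof. by rewrite card_ord. Qed.

Section OneRound.
Variables (f : gT -> R) (L : nat).
Let fs s := iter s P f.
Let c := 3 * (sqnorm f - sqnorm (fs L.+1)).
Notation small := (norm_le c).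

Let step_small s i : (s <= L)%N ->
  small 1 (fun y => fs s (rho_map g h i y) - fs s.+1 y).
Proof.
move=> sL; rewrite /norm_le expr1n mul1r.
apply: le_trans (sqnorm_step_le A_gt0 st_inj (fs s) i) _.
rewrite card_ord /c ler_wpM2l // lerB //.
  exact: (le_sqnorm_iter A_gt0 st_inj f (leq0n s)).
exact: (le_sqnorm_iter A_gt0 st_inj f (sL : (s.+1 <= L.+1)%N)).
Qed.

Let mulg_inj (z : gT) : injective (fun y => (z * y)%g).
Proof. exact: mulgI. Qed.

(** Both y -> g^2 y^2 and y -> g y^2 are compositions of two moves, one of them
    squaring, so f_s composed with either is close to f_(s+2). *)
Let translate1_small s : (s < L)%N ->
  small 4 (fun y => fs s (g * y)%g - fs s y).
Proof.
move=> sL.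
have h1 := step_small 0 (ltnW sL).
have h2 := step_small (inord 2) (ltnW sL).
have h3 := step_small 0 sL.
have h4 := step_small (inord 2) sL.
rewrite /rho_map /= inordK //= in h1 h2 h3 h4.
(* the points g y^2 exhaust the group, and there the difference telescopes *)
have inj1 : injective (fun y : gT => (g * y ^+ 2)%g).
  by move=> x y /mulgI /(sqr_inj_odd odd_G).
apply/(norm_le_comp _ _ _ inj1).
have k1 := (norm_le_comp _ _ _ (sqr_inj_odd odd_G)).2 h1.
have k2 := (norm_le_comp _ _ _ (@mulg_inj g)).2 h2.
apply: eq_norm_le (norm_leB (norm_leD k2 h3) (norm_leD k1 h4)) => y /=.
rewrite (_ : (g * y) ^+ 2 = g * (g * y ^+ 2))%g; first by ring.
rewrite expgMn; last exact: generator_mulC.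
by rewrite [(g ^+ 2)%g]expgS expg1 -mulgA.
Qed.

(** Squaring turns translation by g^(2m) of f_s into translation by g^m of
    f_(s+1); each binary digit costs at most 4 + 2 units. *)
Lemma translate_small j s m : (s + j <= L)%N -> (m < 2 ^ j)%N ->
  small (6 * j) (fun y => fs s (g ^+ m * y)%g - fs s y).
Proof.
elim: j s m => [|j IH] s m sj.
  case: m => // _; rewrite /norm_le /sqnorm big1 ?muln0 ?expr0n ?mul0r // => y _.
  by rewrite mul1g subrr expr0n.
move=> mj.
have even_small : small (6 * j + 2)
    (fun y => fs s (g ^+ (2 * m./2) * y)%g - fs s y).
  apply/(norm_le_comp _ _ _ (sqr_inj_odd odd_G)).
  have h2 := @step_small s (inord 2) (ltac:(lia)).
  rewrite /rho_map /= inordK //= in h2.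
  have h3 := IH s.+1 m./2 (ltac:(lia)) (ltac:(rewrite expnS in mj; lia)).
  have k2 := (norm_le_comp _ _ _ (@mulg_inj (g ^+ m./2)%g)).2 h2.
  rewrite (_ : 6 * j + 2 = 6 * j + 1 + 1)%N; last by lia.
  apply: eq_norm_le (norm_leB (norm_leD h3 k2) h2) => y /=.
  rewrite mulnC expgM -expgMn; first by ring.
  exact: generator_mulC.
have mE := odd_double_half m; case: (odd m) mE => /= mE; last first.
  rewrite -mE add0n -mul2n.
  have le : (6 * j + 2 <= 6 * j.+1)%N by lia.
  apply: le_trans even_small _; rewrite ler_wpM2r //.
    rewrite /c mulr_ge0 // subr_ge0.
    exact: (le_sqnorm_iter A_gt0 st_inj f (leq0n L.+1)).
  by rewrite lerXn2r ?nnegrE ?ler0n // ler_nat.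
have h1 := @translate1_small s (ltac:(lia)).
have k1 := (norm_le_comp _ _ _ (@mulg_inj (g ^+ (2 * m./2))%g)).2 h1.
rewrite (_ : 6 * j.+1 = 4 + (6 * j + 2))%N; last by lia.
apply: eq_norm_le (norm_leD k1 even_small) => y /=.
by rewrite -[in RHS]mE -mul2n expgS mulgA; ring.
Qed.

(** The unit c is three times the loss of squared norm over L + 1 steps, so it
    bounds the distance between each move and the averaging operator at each of
    these steps. *)
Lemma sqnorm_round : \sum_y f y = 0 -> (#|gT| <= 2 ^ L)%N ->
  sqnorm f <= (6 * L)%:R ^+ 2 * c.
Proof.
move=> f0 NL.
have N0 : 0 < N by rewrite ltr0n; apply/card_gt0P; exists g.
have hN : small (#|gT| * (6 * L)) (fun y => - (N * f y)).
  have hs := @norm_le_sum R gT c (6 * L) #|gT|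
    (fun m y => f (g ^+ m * y)%g - f y) (fun m mN =>
      @translate_small L 0 m (leqnn L) (leq_trans mN NL)).
  apply: eq_norm_le hs => y /=.
  by rewrite sumrB sum_generator f0 sub0r sumr_const_nat subn0 mulr_natl.
move: hN; rewrite /norm_le /sqnorm natrM.
under eq_bigr do rewrite sqrrN exprMn.
rewrite -mulr_sumr exprMn -[X in _ <= X -> _]mulrA ler_pM2l //.
by rewrite exprn_gt0.
Qed.

End OneRound.

(** The previous bound solved for the norm after the round: 108 = 6^2 * 3. *)
Lemma sqnorm_contract L f : (0 < L)%N -> (#|gT| <= 2 ^ L)%N ->
  \sum_y f y = 0 ->
  sqnorm (iter L.+1 P f) <= (1 - (108 * L ^ 2)%:R^-1) * sqnorm f.
Proof.
move=> L0 NL f0; have := sqnorm_round f0 NL.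
set x := sqnorm f; set x' := sqnorm _.
have K0 : 0 < (108 * L ^ 2)%:R :> R by rewrite ltr0n muln_gt0 expn_gt0 L0.
have -> : (6 * L)%:R ^+ 2 * (3 * (x - x')) = (108 * L ^ 2)%:R * (x - x').
  by rewrite !natrM; ring.
rewrite mulrC -ler_pdivrMr // => le.
by rewrite mulrBl mul1r mulrC; lra.
Qed.

Lemma sqnorm_contract_iter L f t : (0 < L)%N -> (#|gT| <= 2 ^ L)%N ->
  \sum_y f y = 0 ->
  sqnorm (iter (t * L.+1) P f) <= (1 - (108 * L ^ 2)%:R^-1) ^+ t * sqnorm f.
Proof.
move=> L0 NL f0; elim: t => [|t IH]; first by rewrite mul1r.
rewrite mulSn iterD exprS -mulrA.
apply: le_trans (sqnorm_contract L0 NL _) _.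
  by rewrite sum_iter_transfer.
rewrite ler_wpM2l // subr_ge0 invf_le1 ?ler1n ?ltr0n muln_gt0 expn_gt0 L0 //.
Qed.

(** Rounds of L + 1 steps, 108 L^2 of them to halve the squared norm, and 4L
    halvings to bring it below N^(-4) when N <= 2^L. *)
Definition mixing_time L := ((108 * L ^ 2) * (4 * L) * L.+1)%N.

(** A value is at most the norm, and the norm of a centred Dirac mass is at most
    1 at the start. *)
Lemma rho_kernel_bound L u v : (0 < L)%N -> (#|gT| <= 2 ^ L)%N ->
  `|iter (mixing_time L) P (dirac R v) u - N^-1| <= N^-1 * N^-1.
Proof.
move=> L0 NL.
have N0 : 0 < N by rewrite ltr0n; apply/card_gt0P; exists g.
have sum_cst a : \sum_(y : gT) a = a * N by rewrite sumr_const mulr_natr.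
pose f z := dirac R v z - N^-1.
have f0 : \sum_y f y = 0.
  rewrite sumrB sum_dirac sum_cst.
  by rewrite mulVf ?subrr // gt_eqF.
have f1 : sqnorm f <= 1.
  rewrite /sqnorm (eq_bigr (fun y => (1 - 2 * N^-1) * dirac R v y + N^-1 ^+ 2)).
    rewrite big_split /= -mulr_sumr sum_dirac sum_cst.
    rewrite mulr1 expr2 -mulrA mulVf ?gt_eqF // mulr1.
    have : 0 < N^-1 by rewrite invr_gt0.
    lra.
  by move=> y _; rewrite /f /dirac; case: (y == v) => /=; ring.
have -> : iter (mixing_time L) P (dirac R v) u - N^-1
    = iter (mixing_time L) P f u.
  rewrite iter_transferD; congr (_ + _).
  by rewrite iter_transfer_cst.
have sq : iter (mixing_time L) P f u ^+ 2 <= (N^-1 * N^-1) ^+ 2.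
  apply: le_trans (sqr_le_sqnorm _ u) _.
  apply: le_trans (sqnorm_contract_iter _ L0 NL f0) _.
  have K0 : (0 < 108 * L ^ 2)%N by rewrite muln_gt0 expn_gt0 L0.
  have i1 : 0 <= 1 - (108 * L ^ 2)%:R^-1 :> R.
    by rewrite subr_ge0 invf_le1 ?ler1n ?ltr0n.
  rewrite exprM -[leRHS]mulr1; apply: ler_pM => //.
  - by rewrite !exprn_ge0.
  - exact: sqnorm_ge0.
  have -> : (N^-1 * N^-1) ^+ 2 = N^-1 ^+ 4 by ring.
  apply: (@le_trans _ _ ((2^-1) ^+ (4 * L))).
    by rewrite lerXn2r ?nnegrE ?exprn_ge0 ?invr_ge0 // half_power_bound.
  rewrite mulnC exprM lerXn2r ?nnegrE ?exprn_ge0 ?invr_ge0 ?ler0n //.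
  by rewrite exprVn lef_pV2 ?posrE ?exprn_gt0 // -natrX ler_nat.
by rewrite -ler_sqr ?nnegrE ?mulr_ge0 ?invr_ge0 // real_normK ?num_real.
Qed.

Lemma rho_mixes L : (0 < L)%N -> (#|gT| <= 2 ^ L)%N ->
  mixes (rho_map g h) (mixing_time L) N^-1.
Proof.
move=> L0 NL phi u phi0.
rewrite iter_transfer_kernel // [X in X <= _ <= _]mulrC [X in _ <= _ <= X]mulrC.
rewrite !mulr_suml; apply/andP; split; apply: ler_sum => v _;
  rewrite ler_wpM2l //; have := rho_kernel_bound u v L0 NL;
  rewrite ler_norml; case/andP; set x := iter _ _ _ _; lra.
Qed.

End Mixing.

(** * Correlations at short range *)

Section NatSums.
Variable R : realFieldType.
Implicit Types x : nat -> R.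

Lemma sum_nat_widen x A A' : (forall a, 0 <= x a) -> (A <= A')%N ->
  \sum_(0 <= a < A) x a <= \sum_(0 <= a < A') x a.
Proof.
move=> x0 le; rewrite [leRHS](big_cat_nat (n := A)) //= lerDl.
exact: sumr_ge0.
Qed.

Lemma sum_nat_succ x A A' : (forall a, 0 <= x a) -> (A < A')%N ->
  \sum_(0 <= a < A) x a
    <= \sum_(0 <= a < A') (if a is a'.+1 then x a' else 0).
Proof.
case: A' => // A' x0 le; rewrite big_nat_recl //= add0r.
exact: sum_nat_widen.
Qed.

Lemma sum_nat_double x A :
  \sum_(0 <= a < 2 * A) (if odd a then 0 else x a./2)
    = \sum_(0 <= a < A) x a.
Proof.
elim: A => [|A IH]; first by rewrite !big_geq.
rewrite mul2n doubleS -mul2n !big_nat_recr //= IH mul2n odd_double /=.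
by rewrite doubleK addr0.
Qed.

Lemma sum_nat_half x A A' : (forall a, 0 <= x a) -> (2 * A <= A')%N ->
  \sum_(0 <= a < A) x a
    <= \sum_(0 <= a < A') (if odd a then 0 else x a./2).
Proof.
move=> x0 le; rewrite -sum_nat_double; apply: sum_nat_widen => // a.
by case: ifP.
Qed.

(** The limit 15 is what turns 3 * 2 into kappa = 90. *)
Lemma sum_max_geometric n :
  \sum_(0 <= k < n) \sum_(0 <= l < n) ((2 / 3) ^+ maxn k l : R)
    = 15 - (6 * n%:R + 15) * (2 / 3) ^+ n.
Proof.
elim: n => [|n IH]; first by rewrite big_geq // mulr0 expr0; ring.
rewrite big_nat_recr //=.
have e1 : \sum_(0 <= i < n.+1) ((2 / 3) ^+ maxn n i : R)
    = n.+1%:R * (2 / 3) ^+ n.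
  rewrite [RHS]mulr_natl (eq_big_nat _ _ (F2 := fun=> (2 / 3) ^+ n)).
    by rewrite sumr_const_nat subn0.
  by move=> i /andP[_ lt]; rewrite (maxn_idPl _).
have e2 : \sum_(0 <= i < n) \sum_(0 <= l < n.+1) ((2 / 3) ^+ maxn i l : R)
    = \sum_(0 <= k < n) \sum_(0 <= l < n) (2 / 3) ^+ maxn k l
      + n%:R * (2 / 3) ^+ n.
  have -> : n%:R * (2 / 3) ^+ n = \sum_(0 <= i < n) ((2 / 3) ^+ n : R).
    by rewrite sumr_const_nat subn0 [LHS]mulr_natl.
  rewrite -big_split /=.
  apply: eq_big_nat => i /andP[_ lt]; rewrite big_nat_recr //=.
  by rewrite (maxn_idPr (ltnW lt)).
rewrite e1 e2 IH -natr1 exprS; move: ((2 / 3) ^+ n) => r; by field.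
Qed.

End NatSums.

Section ParityBound.
Variable R : realFieldType.
Implicit Type m : nat -> R.

(** Bounds for the weights of words with an even and with an odd exponent of g,
    as functions of the exponent b of h, where m(b) accounts for the words
    that end in a squaring.  They solve the system obtained from the last letter:
    e(b) = (o(b) + e(b-1) + m(b)) / 3 and o(b) = (e(b) + o(b-1)) / 3, because a
    last letter g flips the parity and a squaring leaves an even exponent. *)
Fixpoint parity_bound m b : R * R :=
  let: (e, o) := if b is b'.+1 then parity_bound m b' else (0, 0) in
  let e' := (3 * e + o + 3 * m b) / 8 in (e', (e' + o) / 3).

Definition even_bound m b := (parity_bound m b).1.
Definition odd_bound m b := (parity_bound m b).2.

Lemma even_bound0 m : even_bound m 0 = 3 / 8 * m 0%N.
Proof. by rewrite /even_bound /=; ring. Qed.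

Lemma odd_bound0 m : odd_bound m 0 = even_bound m 0 / 3.
Proof. by rewrite /even_bound /odd_bound /=; ring. Qed.

Lemma even_boundS m b : even_bound m b.+1
  = (3 * even_bound m b + odd_bound m b + 3 * m b.+1) / 8.
Proof. by rewrite /even_bound /odd_bound /=; case: (parity_bound m b). Qed.

Lemma odd_boundS m b : odd_bound m b.+1
  = (even_bound m b.+1 + odd_bound m b) / 3.
Proof. by rewrite /even_bound /odd_bound /=; case: (parity_bound m b). Qed.

Lemma parity_bound_order m b : (forall c, 0 <= m c) ->
  0 <= odd_bound m b <= even_bound m b.
Proof.
move=> m0; elim: b => [|b /andP[o0 oe]].
  rewrite odd_bound0 even_bound0; have := m0 0%N.
  by move=> ?; apply/andP; split; lra.
rewrite odd_boundS even_boundS; have := m0 b.+1.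
by move=> ?; apply/andP; split; lra.
Qed.

(** Summing the system over b gives the factor 2/3 of one stretch between
    squarings; the two boundary terms make the relation exact. *)
Lemma sum_even_bound m n :
  \sum_(0 <= b < n.+1) even_bound m b
    + 2 / 3 * even_bound m n + odd_bound m n / 3
  = 2 / 3 * \sum_(0 <= b < n.+1) m b.
Proof.
elim: n => [|n IH]; first by rewrite !big_nat1 odd_bound0 even_bound0; field.
rewrite big_nat_recr //= [in RHS]big_nat_recr //= mulrDr -IH.
by rewrite odd_boundS even_boundS; field.
Qed.

(** Words with k + 1 squarings ending in a squaring come from words with k
    squarings by halving the exponents.  At k = 0 the source is the empty word,
    and 3 cancels the factor 1/3 of a letter that it does not have. *)
Fixpoint block_source k : nat -> R :=
  if k is k'.+1
  then fun b => if odd b then 0 else even_bound (block_source k') b./2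
  else fun b => 3 * (b == 0%N)%:R.

Lemma block_source_ge0 k b : 0 <= block_source k b.
Proof.
elim: k b => [|k IH] b /=; first by rewrite mulr_ge0.
case: ifP => // _; have /andP[] := parity_bound_order b./2 IH.
exact: le_trans.
Qed.

Lemma sum_even_bound_block k B :
  \sum_(0 <= b < B) even_bound (block_source k) b <= 2 * (2 / 3) ^+ k.
Proof.
have half j B' : \sum_(0 <= b < B') even_bound (block_source j) b
    <= 2 / 3 * \sum_(0 <= b < B') block_source j b.
  case: B' => [|B']; first by rewrite !big_geq // mulr0.
  rewrite -sum_even_bound.
  have /andP[? ?] := parity_bound_order B' (block_source_ge0 j).
  lra.
apply: le_trans (half k B) _.
elim: k B => [|k IH] B.
  case: B => [|B]; first by rewrite big_geq // expr0; lra.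
  rewrite big_nat_recl // big1 ?addr0 /=; last by move=> i _; rewrite mulr0.
  rewrite expr0; lra.
have e0 b : 0 <= even_bound (block_source k) b.
  by have /andP[/le_trans] := parity_bound_order b (block_source_ge0 k); apply.
have le : \sum_(0 <= b < B) block_source k.+1 b
    <= \sum_(0 <= b < B) even_bound (block_source k) b.
  rewrite -(sum_nat_double (even_bound (block_source k)) B).
  by apply: sum_nat_widen; [exact: block_source_ge0 | lia].
rewrite exprS [leRHS]mulrCA; apply: ler_wpM2l; first by rewrite divr_ge0.
apply: le_trans le _; apply: le_trans (half k B) _; exact: IH.
Qed.

End ParityBound.

Section Layers.
Variables (R : realFieldType) (gT : finGroupType) (g h : gT).
Hypothesis odd_G : odd #|gT|.
Hypothesis gen_g : generator [set: gT] g.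
Notation P := (transfer (R := R) (rho_map g h)).
Implicit Type phi : gT -> R.

Let A_gt0 : (0 < #|'I_3|)%N. Proof. by rewrite card_ord. Qed.

Lemma rho_transferE phi u :
  P phi u = (phi (g * u)%g + phi (h * u)%g + phi (u ^+ 2)%g) / 3.
Proof.
by rewrite /transfer /avg card_ord !big_ord_recl big_ord0 addr0 addrA.
Qed.

(** The part of the d-step operator due to words with exactly k squarings,
    decomposed along the first letter. *)
Fixpoint graded d k phi u : R :=
  if d is d'.+1 then
    (graded d' k phi (g * u)%g + graded d' k phi (h * u)%g
      + (if k is k'.+1 then graded d' k' phi (u ^+ 2)%g else 0)) / 3
  else if k is 0 then phi u else 0.

Lemma graded_ge0 d k phi u : (forall v, 0 <= phi v) -> 0 <= graded d k phi u.
Proof.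
move=> phi0; elim: d k u => [|d IH] [|k] u //=; rewrite divr_ge0 //.
  by rewrite addr0 addr_ge0.
by rewrite !addr_ge0.
Qed.

Lemma iter_transfer_graded d M phi u : (d < M)%N ->
  iter d P phi u = \sum_(0 <= k < M) graded d k phi u.
Proof.
elim: d M u => [|d IH] [//|M] u dM.
  by rewrite big_nat_recl // big1 ?addr0.
rewrite iterS rho_transferE.
rewrite (IH M.+1 (g * u)%g (ltnW dM)) (IH M.+1 (h * u)%g (ltnW dM)).
rewrite (IH M (u ^+ 2)%g dM) /= -mulr_suml !big_split /=.
congr ((_ + _) / _).
by rewrite [RHS]big_nat_recl //= add0r.
Qed.

(** The same decomposition along the last letter: the first letter is convenient
    for saturating the number of squarings, the last one for reading parities. *)
Lemma graded_last d k phi u : graded d.+1 k phi u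
  = (graded d k (fun v => phi (g * v)%g) u + graded d k (fun v => phi (h * v)%g) u
     + (if k is k'.+1 then graded d k' (fun v => phi (v ^+ 2)%g) u else 0)) / 3.
Proof.
elim: d k u => [|d IH] k u; first by case: k => [|[|k]].
have -> : graded d.+2 k phi u = (graded d.+1 k phi (g * u)%g
    + graded d.+1 k phi (h * u)%g
    + (if k is k'.+1 then graded d.+1 k' phi (u ^+ 2)%g else 0)) / 3 by [].
by rewrite !IH; case: k => [|k]; rewrite ?IH /=; field.
Qed.

Definition layer T k phi u : R := \sum_(0 <= d < T) graded d k phi u.

Lemma layer_ge0 T k phi u : (forall v, 0 <= phi v) -> 0 <= layer T k phi u.
Proof. by move=> phi0; apply: sumr_ge0 => d _; apply: graded_ge0. Qed.

Lemma layerS_first T k phi u : layer T.+1 k phi u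
  = (if k is 0 then phi u else 0)
    + (layer T k phi (g * u)%g + layer T k phi (h * u)%g
       + (if k is k'.+1 then layer T k' phi (u ^+ 2)%g else 0)) / 3.
Proof.
rewrite /layer big_nat_recl //=; congr (_ + _).
rewrite -mulr_suml !big_split /=; congr ((_ + _) / _).
by case: k => //; rewrite big1.
Qed.

Lemma layerS_last T k phi u : layer T.+1 k phi u
  = (if k is 0 then phi u else 0)
    + (layer T k (fun v => phi (g * v)%g) u
       + layer T k (fun v => phi (h * v)%g) u
       + (if k is k'.+1 then layer T k' (fun v => phi (v ^+ 2)%g) u else 0)) / 3.
Proof.
rewrite /layer big_nat_recl //=; congr (_ + _).
under eq_bigr => d _ do rewrite -[_ / 3]/(graded d.+1 k phi u) graded_last.
rewrite -mulr_suml !big_split /=; congr ((_ + _) / _).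
by case: k => //; rewrite big1.
Qed.

Lemma green_layers T phi u :
  green (rho_map g h) T phi u = \sum_(0 <= k < T) layer T k phi u.
Proof.
rewrite /green /layer exchange_big /=; apply: eq_big_nat => d /andP[_ dT].
exact: iter_transfer_graded.
Qed.

(** By induction on the first letter: the total mass m of layer k satisfies
    m <= 1 + 2/3 m when k = 0 and m <= 2/3 m + 1/3 m' otherwise, so 3 is a fixed
    bound. *)
Lemma sum_layer_from T k u : \sum_v layer T k (dirac R v) u <= 3.
Proof.
elim: T k u => [|T IH] k u.
  by rewrite big1 // => v _; rewrite /layer big_geq.
under eq_bigr => v _ do rewrite layerS_first.
rewrite big_split /= -mulr_suml !big_split /=.
have h1 := IH k (g * u)%g; have h2 := IH k (h * u)%g.
case: k h1 h2 => [|k] h1 h2.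
  have -> : \sum_v dirac R v u = 1.
    rewrite -[RHS](sum_dirac R u); apply: eq_bigr => v _.
    by rewrite /dirac eq_sym.
  by rewrite big1_eq; lra.
rewrite big1_eq; have h3 := IH k (u ^+ 2)%g; lra.
Qed.

Lemma sum_layer_to T k phi : (forall v, 0 <= phi v) ->
  \sum_u layer T k phi u <= 3 * \sum_u phi u.
Proof.
move=> phi0; have s0 : 0 <= \sum_u phi u by apply: sumr_ge0.
elim: T k => [|T IH] k.
  by rewrite big1 ?mulr_ge0 // => v _; rewrite /layer big_geq.
under eq_bigr => v _ do rewrite layerS_first.
rewrite big_split /= -mulr_suml !big_split /=.
rewrite -(reindex_inj (mulgI g) (P := xpredT) (F := layer T k phi)).
rewrite -(reindex_inj (mulgI h) (P := xpredT) (F := layer T k phi)).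
have h1 := IH k; case: k h1 => [|k] h1.
  by rewrite big1_eq; lra.
rewrite big1_eq.
rewrite -(reindex_inj (sqr_inj_odd odd_G) (P := xpredT) (F := layer T k phi)).
by have h2 := IH k; lra.
Qed.

(** The total weight of the words with fewer than T letters and k squarings that
    send u to u^(2^k) g^a h^b, with a and b taken as natural numbers rather than
    modulo N: parity makes sense only before the reduction. *)
Fixpoint weight T k a b : R :=
  if T is T'.+1 then
    [&& k == 0, a == 0 & b == 0]%N%:R
    + ((if a is a'.+1 then weight T' k a' b else 0)
       + (if b is b'.+1 then weight T' k a b' else 0)
       + (if k is k'.+1 then
            if odd a then 0 else if odd b then 0 else weight T' k' a./2 b./2
          else 0)) / 3
  else 0.

Lemma weight_ge0 T k a b : 0 <= weight T k a b.
Proof.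
elim: T k a b => //= T IH k a b; rewrite addr_ge0 ?ler0n // divr_ge0 //.
rewrite !addr_ge0 //; [by case: a | by case: b | case: k => // k].
by case: ifP => // _; case: ifP.
Qed.

Lemma sum2_succ (x : nat -> nat -> R) A A' :
  (forall a b, 0 <= x a b) -> (A < A')%N ->
  \sum_(0 <= a < A) \sum_(0 <= b < A) x a b
    <= \sum_(0 <= a < A') \sum_(0 <= b < A')
         (if a is a'.+1 then x a' b else 0).
Proof.
move=> x0 le.
apply: le_trans (sum_nat_succ (fun a => sumr_ge0 _ (fun b _ => x0 a b)) le) _.
apply: ler_sum => [[|a]] _; first by rewrite big1.
by apply: sum_nat_widen => //; apply: ltnW.
Qed.

Lemma sum2_half (x : nat -> nat -> R) A A' :
  (forall a b, 0 <= x a b) -> (2 * A <= A')%N ->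
  \sum_(0 <= a < A) \sum_(0 <= b < A) x a b
    <= \sum_(0 <= a < A') \sum_(0 <= b < A')
         (if odd a then 0 else if odd b then 0 else x a./2 b./2).
Proof.
move=> x0 le.
apply: le_trans (sum_nat_half (fun a => sumr_ge0 _ (fun b _ => x0 a b)) le) _.
apply: ler_sum => a _; case: ifP => _; first by rewrite big1.
exact: (sum_nat_half (x0 _) le).
Qed.

Lemma weightS_mul T k a b (w : R) : weight T.+1 k a b * w
  = [&& k == 0, a == 0 & b == 0]%N%:R * w
    + ((if a is a'.+1 then weight T k a' b * w else 0)
       + (if b is b'.+1 then weight T k a b' * w else 0)
       + (if k is k'.+1 then
            if odd a then 0
            else if odd b then 0 else weight T k' a./2 b./2 * w
          else 0)) / 3.
Proof.
rewrite [weight _ _ _ _]/= mulrDl; congr (_ + _).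
rewrite [LHS]mulrAC; congr (_ / _); rewrite !mulrDl; congr (_ + _ + _).
- by case: a => *; rewrite ?mul0r.
- by case: b => *; rewrite ?mul0r.
by case: k => *; do ?case: ifP => _; rewrite ?mul0r.
Qed.

Lemma layer_le_weight T k phi u : (forall v, 0 <= phi v) ->
  layer T k phi u <= \sum_(0 <= a < T * 2 ^ k) \sum_(0 <= b < T * 2 ^ k)
    weight T k a b * phi (u ^+ (2 ^ k) * g ^+ a * h ^+ b)%g.
Proof.
have mC := generator_mulC gen_g.
elim: T k phi => [|T IH] k phi phi0.
  by rewrite /layer mul0n !big_geq.
rewrite layerS_last.
have w0 := weight_ge0.
set A' := (T.+1 * 2 ^ k)%N.
have A'0 : (0 < A')%N by rewrite muln_gt0 expn_gt0.
have AA : (T * 2 ^ k < A')%N by rewrite ltn_pmul2r // expn_gt0.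
pose S (x : nat -> nat -> R) := \sum_(0 <= a < A') \sum_(0 <= b < A') x a b.
have SD x x' : S (fun a b => x a b + x' a b) = S x + S x'.
  by rewrite -big_split; apply: eq_bigr => a _; rewrite -big_split.
have SZ x c : S (fun a b => x a b * c) = S x * c.
  by rewrite mulr_suml; apply: eq_bigr => a _; rewrite mulr_suml.
have eS x x' : (forall a b, x a b = x' a b) -> S x = S x'.
  by move=> e; apply: eq_bigr => a _; apply: eq_bigr => b _.
rewrite -[leRHS]/(S _) (eS _ _ (fun a b => weightS_mul T k a b _)).
rewrite SD SZ !SD; apply: lerD.
  rewrite /S big_ltn // [X in X + _]big_ltn //= !expg0 !mulg1 -addrA.
  apply: ler_wpDr.
    by rewrite addr_ge0 // !sumr_ge0 // => a _; rewrite ?sumr_ge0 // => *;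
      rewrite mulr_ge0 ?ler0n.
  by case: k {IH A' A'0 AA S SD SZ eS} => [|k];
    rewrite ?mul1r ?mul0r ?eqxx ?expn0 ?expg1.
apply: ler_wpM2r; first by rewrite invr_ge0.
apply: lerD; first apply: lerD.
- apply: le_trans (IH _ _ _) _ => [v|]; first exact: phi0.
  pose x a b := weight T k a b * phi (u ^+ (2 ^ k) * g ^+ a.+1 * h ^+ b)%g.
  rewrite (eS _ (fun a b => if a is a'.+1 then x a' b else 0)); last by case.
  apply: le_trans (sum2_succ (x := x) _ AA) => [|a b]; last exact: mulr_ge0.
  apply: ler_sum => a _; apply: ler_sum => b _; rewrite /x.
  by rewrite expgS !mulgA (mC g).
- apply: le_trans (IH _ _ _) _ => [v|]; first exact: phi0.
  pose x b a := weight T k a b * phi (u ^+ (2 ^ k) * g ^+ a * h ^+ b.+1)%g.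
  rewrite (eS _ (fun a b => if b is b'.+1 then x b' a else 0)); last first.
    by move=> a; case.
  rewrite /S [leLHS]exchange_big [leRHS]exchange_big /=.
  apply: le_trans (sum2_succ (x := x) _ AA) => [|a b]; last exact: mulr_ge0.
  apply: ler_sum => b _; apply: ler_sum => a _; rewrite /x.
  by rewrite (mC h) expgSr !mulgA.
case: k @A' A'0 AA @S SD SZ eS => [|k] A' A'0 AA S SD SZ eS.
  by apply: sumr_ge0 => a _; apply: sumr_ge0.
apply: le_trans (IH _ _ _) _ => [v|]; first exact: phi0.
have A2 : (2 * (T * 2 ^ k) <= A')%N by rewrite /A' expnS; lia.
pose x a b := weight T k a b
  * phi (u ^+ (2 ^ k.+1) * g ^+ (2 * a) * h ^+ (2 * b))%g.
rewrite (eS _ (fun a b =>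
  if odd a then 0 else if odd b then 0 else x a./2 b./2)); last first.
  move=> a b; have := odd_double_half a; have := odd_double_half b.
  case: (odd a) => //; case: (odd b) => // eb ea; rewrite /x.
  by rewrite !mul2n -[X in _ = _ * phi (_ * g ^+ X * _)%g]add0n ea
    -[X in _ = _ * phi (_ * h ^+ X)%g]add0n eb.
apply: le_trans (sum2_half (x := x) _ A2) => [|a b]; last exact: mulr_ge0.
apply: ler_sum => a _; apply: ler_sum => b _; rewrite /x.
by rewrite !expgMn // -!expgM mulnC expnSr ![(2 * _)%N]mulnC.
Qed.

(** The last letter recursion of [weight] is the system solved by
    [parity_bound], and even exponents have the larger bound. *)
Lemma weight_le_parity T k a b : weight T k a b
  <= if odd a then odd_bound (block_source R k) b
     else even_bound (block_source R k) b.
Proof.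
have ord j c := parity_bound_order c (@block_source_ge0 R j).
elim: T k a b => [|T IH] k a b.
  by rewrite /=; have /andP[] := ord k b; case: (odd a); lra.
have evb : even_bound (block_source R k) b = (odd_bound (block_source R k) b
    + (if b is b'.+1 then even_bound (block_source R k) b' else 0)
    + block_source R k b) / 3.
  case: b => [|b]; rewrite ?odd_bound0 ?even_bound0 ?odd_boundS ?even_boundS;
    by field.
have odb : odd_bound (block_source R k) b = (even_bound (block_source R k) b
    + (if b is b'.+1 then odd_bound (block_source R k) b' else 0)) / 3.
  by case: b {evb} => [|b]; rewrite ?odd_bound0 ?odd_boundS; field.
have wa : (if a is a'.+1 then weight T k a' b else 0)
    <= if odd a then even_bound (block_source R k) b
       else odd_bound (block_source R k) b.
  case: a => [|a] /=; first by case/andP: (ord k b).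
  by have := IH k a b; case: (odd a).
have wb : (if b is b'.+1 then weight T k a b' else 0)
    <= (if b is b'.+1 then
          if odd a then odd_bound (block_source R k) b'
          else even_bound (block_source R k) b'
        else 0).
  by case: b {evb odb wa} => // b; apply: IH.
rewrite [weight _ _ _ _]/=.
case oa: (odd a) wa wb => wa wb.
  rewrite odb; case: a oa wa wb => // a oa wa wb.
  rewrite andbF /= add0r; apply: ler_wpM2r; first by rewrite invr_ge0.
  rewrite [X in _ + X <= _](_ : _ = 0); last by case: (k).
  by rewrite addr0 lerD.
rewrite evb.
have wk : 3 * [&& k == 0, a == 0 & b == 0]%N%:R
    + (if k is k'.+1 then
         if odd b then 0 else weight T k' a./2 b./2 else 0)
    <= block_source R k b.
  case: (k) => [|k'] /=.
    rewrite addr0 ler_wpM2l // ler_nat.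
    by case: (a == 0%N).
  rewrite mulr0 add0r; case: ifP => // ob.
  have := IH k' a./2 b./2; have /andP[_] := ord k' b./2.
  by case: (odd a./2) => // le1 le2; apply: le_trans le2 le1.
have sum3 (x0 x1 x2 x3 o e m : R) : 3 * x0 + x3 <= m -> x1 <= o -> x2 <= e ->
  x0 + (x1 + x2 + x3) / 3 <= (o + e + m) / 3 by lra.
exact: sum3 wk wa wb.
Qed.

(** All exponents a that occur are below T 2^k <= N, so for each b at most one of
    them leads to v; the even bound dominates both parities and its sum over b
    is geometric. *)
Lemma layer_le_geometric T k u v : (T * 2 ^ k <= #|gT|)%N ->
  layer T k (dirac R v) u <= 2 * (2 / 3) ^+ k.
Proof.
move=> le; apply: le_trans (layer_le_weight _ _ _ (@dirac_ge0 R gT v)) _.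
apply: le_trans (sum_even_bound_block R k (T * 2 ^ k)).
rewrite exchange_big /=; apply: ler_sum => b _.
have /andP[o0 oe] := parity_bound_order b (@block_source_ge0 R k).
set U := (u ^+ (2 ^ k))%g.
rewrite big_mkord.
case: (pickP (fun a : 'I_(T * 2 ^ k) => (U * g ^+ a * h ^+ b)%g == v))
  => [a /eqP av|none]; last first.
  rewrite big1 => [|a _]; first exact: le_trans oe.
  by rewrite /dirac none mulr0.
rewrite (bigD1 a) //= big1 => [|a' a'a].
  rewrite /dirac av eqxx mulr1 addr0.
  by have := weight_le_parity T k a b; case: (odd a) => // /le_trans; apply.
rewrite /dirac -av (can_eq (mulgK _)) (inj_eq (mulgI _)).
rewrite eq_expg_mod_order (order_generator gen_g).
rewrite !modn_small; try exact: leq_trans (ltn_ord _) le.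
by rewrite (negbTE (_ : (a' : nat) != a)) ?mulr0.
Qed.

(** Beyond K0 squarings the words are split after enough first letters to leave
    K0 squarings, and averaging over those letters keeps the bound. *)
Lemma layer_le_saturated T K0 k u v : (T * 2 ^ K0 <= #|gT|)%N ->
  layer T k (dirac R v) u <= 2 * (2 / 3) ^+ minn k K0.
Proof.
move=> le; have [kK|Kk] := leqP k K0.
  apply: layer_le_geometric; apply: leq_trans le.
  by rewrite leq_mul2l leq_exp2l // kK orbT.
suff H t : (t <= T)%N -> forall j w, (K0 <= j)%N ->
    layer t j (dirac R v) w <= 2 * (2 / 3) ^+ K0.
  by apply: H => //; apply: ltnW.
set M := 2 * _; have M0 : 0 <= M by rewrite mulr_ge0 // exprn_ge0 // divr_ge0.
elim: t => [|t IH] tT j w; first by rewrite /layer big_geq.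
rewrite leq_eqVlt => /orP[/eqP <-|Kj].
  apply: layer_le_geometric; apply: leq_trans le.
  by rewrite leq_mul2r tT orbT.
have {}IH := IH (ltnW tT).
rewrite layerS_first; case: j Kj => // j Kj.
have h1 := IH j.+1 (g * w)%g (ltnW Kj).
have h2 := IH j.+1 (h * w)%g (ltnW Kj).
have h3 := IH j (w ^+ 2)%g Kj.
lra.
Qed.

Definition kappa_bound T K0 : R := 90 + 6 * T%:R ^+ 2 * (2 / 3) ^+ K0.

(** In each product of two layers the smaller pointwise bound is used for one
    factor and the mass 3 for the other. *)
Lemma sum_layer_product T K0 (f f' : nat -> gT -> R) :
  (forall k v, 0 <= f k v <= 2 * (2 / 3) ^+ minn k K0) ->
  (forall k v, 0 <= f' k v <= 2 * (2 / 3) ^+ minn k K0) ->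
  (forall k, \sum_v f k v <= 3) -> (forall k, \sum_v f' k v <= 3) ->
  \sum_v (\sum_(0 <= k < T) f k v) * (\sum_(0 <= l < T) f' l v)
  <= kappa_bound T K0.
Proof.
move=> hf hf' sf sf'; set q : R := 2 / 3.
have q0 : 0 <= q by rewrite divr_ge0.
have q1 : q <= 1 by rewrite /q; lra.
have pair k l : \sum_v f k v * f' l v
    <= 6 * q ^+ maxn k l + 6 * q ^+ K0.
  have b0 j : 0 <= 2 * q ^+ minn j K0 by rewrite mulr_ge0 // exprn_ge0.
  have sat j : 3 * (2 * q ^+ minn j K0) <= 6 * q ^+ j + 6 * q ^+ K0.
    have qj := exprn_ge0 j q0; have qK := exprn_ge0 K0 q0.
    by rewrite /minn; case: ifP => _; lra.
  have [lk|kl] := leqP l k.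
    apply: le_trans (sat k).
    apply: (@le_trans _ _ (\sum_v (2 * q ^+ minn k K0) * f' l v)).
      apply: ler_sum => v _; apply: ler_wpM2r; first by case/andP: (hf' l v).
      by case/andP: (hf k v).
    by rewrite -mulr_sumr mulrC ler_wpM2r.
  apply: le_trans (sat l).
  apply: (@le_trans _ _ (\sum_v f k v * (2 * q ^+ minn l K0))).
    apply: ler_sum => v _; apply: ler_wpM2l; first by case/andP: (hf k v).
    by case/andP: (hf' l v).
  by rewrite -mulr_suml ler_wpM2r.
apply: (@le_trans _ _ (\sum_(0 <= k < T) \sum_(0 <= l < T)
    (6 * q ^+ maxn k l + 6 * q ^+ K0))).
  under eq_bigr => v _ do rewrite mulr_suml.
  rewrite exchange_big /=; apply: ler_sum => k _.
  under eq_bigr => v _ do rewrite mulr_sumr.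
  by rewrite exchange_big /=; apply: ler_sum => l _; apply: pair.
have -> : \sum_(0 <= k < T) \sum_(0 <= l < T)
    (6 * q ^+ maxn k l + 6 * q ^+ K0)
  = 6 * (\sum_(0 <= k < T) \sum_(0 <= l < T) q ^+ maxn k l)
    + 6 * T%:R ^+ 2 * q ^+ K0.
  rewrite mulr_sumr.
  have -> : 6 * T%:R ^+ 2 * q ^+ K0
      = \sum_(0 <= k < T) \sum_(0 <= l < T) (6 * q ^+ K0).
    by rewrite !sumr_const_nat !subn0 -mulrnA -[RHS]mulr_natr natrM; ring.
  rewrite -big_split /=; apply: eq_bigr => k _.
  by rewrite mulr_sumr -big_split.
rewrite sum_max_geometric lerD2r.
have : 0 <= (6 * T%:R + 15) * q ^+ T.
  by rewrite mulr_ge0 ?exprn_ge0 // addr_ge0 // mulr_ge0.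
lra.
Qed.

Lemma green_kernel T phi u : green (rho_map g h) T phi u
  = \sum_v phi v * green (rho_map g h) T (dirac R v) u.
Proof.
rewrite /green.
under eq_bigr => e _ do rewrite iter_transfer_kernel //.
rewrite exchange_big /=.
by apply: eq_bigr => v _; rewrite mulr_sumr.
Qed.

Lemma layer_dirac_bounds T K0 k u v : (T * 2 ^ K0 <= #|gT|)%N ->
  0 <= layer T k (dirac R v) u <= 2 * (2 / 3) ^+ minn k K0.
Proof.
by move=> le; rewrite layer_ge0 ?layer_le_saturated // => w; apply: dirac_ge0.
Qed.

Lemma sum_layer_to_dirac T k u : \sum_v layer T k (dirac R u) v <= 3.
Proof.
apply: le_trans (sum_layer_to T k (@dirac_ge0 R gT u)) _.
by rewrite sum_dirac mulr1.
Qed.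

Lemma green_returns T K0 u : (T * 2 ^ K0 <= #|gT|)%N ->
  green (rho_map g h) T (green (rho_map g h) T (dirac R u)) u
    <= kappa_bound T K0.
Proof.
move=> le; rewrite green_kernel.
under eq_bigr => v _ do rewrite !green_layers.
apply: (@sum_layer_product T K0 (fun k v => layer T k (dirac R u) v)
  (fun k v => layer T k (dirac R v) u)) => *.
- exact: layer_dirac_bounds.
- exact: layer_dirac_bounds.
- exact: sum_layer_to_dirac.
exact: sum_layer_from.
Qed.

Lemma green_meets T K0 u : (T * 2 ^ K0 <= #|gT|)%N ->
  green (rho_map g h) T (fun v => green (rho_map g h) T (dirac R v) u) u
    <= kappa_bound T K0.
Proof.
move=> le; rewrite green_kernel.
under eq_bigr => v _ do rewrite !green_layers.
apply: (@sum_layer_product T K0 (fun k v => layer T k (dirac R v) u)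
  (fun k v => layer T k (dirac R v) u)) => *.
- exact: layer_dirac_bounds.
- exact: layer_dirac_bounds.
- exact: sum_layer_from.
exact: sum_layer_from.
Qed.

End Layers.

(** * From the random partition to independent letters *)

Section RandomMap.
Variables (R : realFieldType) (A V : finType) (st : A -> V -> V).
Hypothesis A_gt0 : (0 < #|A|)%N.
Variable y : V.
Implicit Types (s : {ffun V -> A}) (n : nat).

Definition random_map s (z : V) : V := st (s z) z.

Notation vertex s n := (iter n (random_map s) y).

Fixpoint word s n : seq A :=
  if n is n'.+1 then s (vertex s n') :: word s n' else [::].

Lemma endpoint_word s n : endpoint st y (word s n) = vertex s n.
Proof. by elim: n => //= n ->. Qed.

Lemma visits_word s n :
  visits st y (word s n) = rev (traject (random_map s) y n.+1).
Proof.
elim: n => // n IH; rewrite trajectSr rev_rcons -IH.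
by rewrite [LHS]/= -/(endpoint st y _) endpoint_word.
Qed.

Notation fresh s n := (uniq (visits st y (word s n))).

Lemma vertex_fresh s n m : fresh s n -> (m < n)%N -> vertex s m != vertex s n.
Proof.
rewrite visits_word rev_uniq trajectSr rcons_uniq => /andP[nin _] mn.
by apply: contraNneq nin => <-; apply/trajectP; exists m.
Qed.

(** A partition is changed only at the current vertex, and only if that vertex is
    new, so that the walk up to that vertex stays the same. *)
Definition resample n s a : {ffun V -> A} :=
  if fresh s n then [ffun z => if z == vertex s n then a else s z] else s.

Lemma word_resample n s a : word (resample n s a) n = word s n.
Proof.
rewrite /resample; case: ifP => // fr.
set s' := finfun _.
suff H m : (m <= n)%N -> word s' m = word s m by apply: H.
elim: m => //= m IH mn; rewrite IH ?(ltnW mn) //; congr (_ :: _).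
rewrite -!endpoint_word IH ?(ltnW mn) // endpoint_word ffunE.
by rewrite (negbTE (vertex_fresh fr mn)).
Qed.

(** The measure preserving exchange behind the Markov property: the letter read at
    a new vertex trades places with an independent one. *)
Definition swap_letter n (p : {ffun V -> A} * A) :=
  (resample n p.1 p.2, if fresh p.1 n then p.1 (vertex p.1 n) else p.2).

Lemma swap_letterK n : involutive (swap_letter n).
Proof.
case=> s a; rewrite /swap_letter /= word_resample -!endpoint_word word_resample.
case fr: (fresh s n); last by rewrite /resample !fr.
have -> : resample n s a (endpoint st y (word s n)) = a.
  by rewrite /resample fr ffunE endpoint_word eqxx.
congr (_, _); rewrite {1}/resample word_resample fr.
apply/ffunP => z; rewrite ffunE -endpoint_word word_resample.
case: eqP => [->//|ne].
by rewrite /resample fr ffunE -endpoint_word; case: eqP.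
Qed.

(** At a new vertex the partition is as good as an independent letter, since
    [swap_letter] is an involution. *)
Lemma sum_fresh_letter n (H : seq A -> A -> R) :
  \sum_(s | fresh s n) H (word s n) (s (vertex s n))
    = \sum_(s | fresh s n) avg (H (word s n)).
Proof.
have A0 : #|A|%:R != 0 :> R by rewrite pnatr_eq0 -lt0n.
apply: (mulIf A0); rewrite /avg -[in RHS]mulr_suml -mulrA mulVf // mulr1.
rewrite mulr_suml.
transitivity (\sum_(s | fresh s n) \sum_(a : A) H (word s n) (s (vertex s n))).
  by apply: eq_bigr => s _; rewrite sumr_const mulr_natr.
rewrite !pair_big_dep /= [LHS](reindex_inj (inv_inj (@swap_letterK n))) /=.
apply: eq_big => [[s a]|[s a]] /=; first by rewrite word_resample.
rewrite word_resample !andbT => fr; rewrite -endpoint_word word_resample.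
by rewrite /resample fr ffunE endpoint_word eqxx.
Qed.

(** By induction on n, with one letter made independent at each step; dropping
    the condition on the last vertex only increases the sum. *)
Lemma sum_fresh_le n (F : seq A -> R) : (forall w, 0 <= F w) ->
  \sum_(s | fresh s n) F (word s n) <= #|{ffun V -> A}|%:R * expect n F.
Proof.
elim: n F => [|n IH] F F0.
  have -> : \sum_(s | fresh s 0) F (word s 0) = \sum_(s : {ffun V -> A}) F [::].
    exact: eq_bigl.
  by rewrite sumr_const mulr_natl.
rewrite [X in _ <= _ * X]/=; apply: le_trans (IH _ _); last first.
  by move=> w; rewrite divr_ge0 // sumr_ge0.
rewrite -(sum_fresh_letter n (fun w a => F (a :: w))) big_mkcond.
rewrite [leRHS]big_mkcond; apply: ler_sum => s _ /=.
by case: (uniq (visits _ _ (word s n))); rewrite ?andbF //; case: ifP.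
Qed.

Lemma collision_time_le_card (f : V -> V) :
  (collision_time f y <= #|V|)%N.
Proof.
rewrite /collision_time; case: ex_minnP => m _ min.
apply: leq_trans (max_card (fconnect f y)); apply: min.
by rewrite /collides_at fingraph.order_gt0 looping_order.
Qed.

Lemma collision_time_fresh s n :
  (n < collision_time (random_map s) y)%N -> fresh s n.
Proof.
rewrite /collision_time; case: ex_minnP => m _ min nm.
rewrite visits_word rev_uniq looping_uniq.
case: n nm => [|n] nm; first by rewrite /looping.
by apply: contraL nm => lp; rewrite -leqNgt; apply: min; rewrite /collides_at lp.
Qed.

Lemma mean_collision_time_le M : (#|V| <= M)%N ->
  (\sum_s (collision_time (random_map s) y)%:R) / #|{ffun V -> A}|%:R
    <= \sum_(0 <= n < M) survival R st n y.
Proof.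
move=> VM.
have S0 : 0 < #|{ffun V -> A}|%:R :> R by rewrite card_ffun ltr0n expn_gt0 A_gt0.
rewrite ler_pdivrMr // mulr_suml.
have e s : (collision_time (random_map s) y)%:R
    = \sum_(0 <= n < M) (n < collision_time (random_map s) y)%N%:R :> R.
  have := collision_time_le_card (random_map s).
  move: (collision_time _ _) => c cV.
  rewrite (big_cat_nat (n := c)) //=; last exact: leq_trans VM.
  rewrite [X in _ + X]big_nat_cond [X in _ + X]big1 ?addr0; last first.
    by move=> i /andP[/andP[ci _] _]; rewrite ltnNge ci.
  rewrite (eq_big_nat _ _ (F2 := fun=> 1)).
    by rewrite sumr_const_nat subn0.
  by move=> i /andP[_ ->].
rewrite (eq_bigr _ (fun s _ => e s)) exchange_big /=; apply: ler_sum => n _.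
rewrite mulrC.
apply: le_trans (sum_fresh_le n (fun w => ler0n R (uniq (visits st y w)))).
rewrite [leRHS]big_mkcond; apply: ler_sum => s _.
case: (boolP (n < _)%N) => [/collision_time_fresh fr|_]; first by rewrite fr.
by case: ifP.
Qed.

End RandomMap.

Lemma expected_collision_time_le (R : realType) (gT : finGroupType)
    (g h y : gT) M : (#|gT| <= M)%N ->
  expected_collision_time R g h y
    <= \sum_(0 <= n < M) survival R (rho_map g h) n y.
Proof. by apply: mean_collision_time_le; rewrite card_ord. Qed.

(** * Orders of magnitude and the final constant *)

(** From d < 2^d for d = q / k, raised to the power k. *)
Lemma pow_le_exp2 k q : (q ^ k <= k ^ k * 2 ^ q)%N.
Proof.
case: k => [|k]; first by rewrite !expn0 mul1n expn_gt0.
have h : (q <= k.+1 * 2 ^ (q %/ k.+1))%N.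
  have := ltn_expl (q %/ k.+1) (isT : (1 < 2)%N).
  have := divn_eq q k.+1; have := ltn_pmod q (isT : (0 < k.+1)%N).
  set d := (q %/ _)%N; set r := (q %% _)%N => rk e lt.
  apply: (@leq_trans (k.+1 * d.+1)%N); last by rewrite leq_mul2l lt.
  by rewrite mulnS mulnC; lia.
apply: (@leq_trans ((k.+1 * 2 ^ (q %/ k.+1)) ^ k.+1)%N).
  by rewrite leq_exp2r.
by rewrite expnMn -expnM leq_mul2l leq_exp2l // leq_divM orbT.
Qed.

Lemma poly_le_exp2 c k :
  exists q0, forall q, (q0 <= q)%N -> (c * q ^ k <= 2 ^ q)%N.
Proof.
exists (c * k.+1 ^ k.+1)%N => q hq.
have K0 : (0 < k.+1 ^ k.+1)%N by rewrite expn_gt0.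
rewrite -(leq_pmul2l K0); apply: leq_trans (pow_le_exp2 k.+1 q).
by rewrite mulnA [(q ^ k.+1)%N]expnS leq_mul2r mulnC hq orbT.
Qed.

Lemma mixing_time_le L : (0 < L)%N -> (mixing_time L <= 864 * L ^ 4)%N.
Proof. by rewrite /mixing_time => L0; rewrite !expnS expn0; nia. Qed.

Section Numerics.
Variable R : realFieldType.

(** In terms of r = x^2 / N the bound reads 1 - m^2 / W with m at least lo^3 r / 2
    and W at most hi^2 r^2 / 4 + hi r Bmax.  After division by r the claim is
    linear in r with nonnegative slope, so it need only hold at r0. *)
Lemma second_moment_numeric (N x z d B lo hi Bmax r0 alpha : R) :
  0 < N -> 0 < x -> 0 <= lo -> lo * x <= z -> lo <= 1 - d -> 0 <= d ->
  1 + d <= hi -> 0 <= B <= Bmax -> 0 < r0 -> r0 * N <= x ^+ 2 -> alpha <= 1 ->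
  (1 - alpha) * (hi ^+ 2 * r0 / 4 + hi * Bmax) <= lo ^+ 6 * r0 / 4 ->
  1 - ((1 - d) * z ^+ 2 / (2 * N)) ^+ 2
      / ((1 + d) ^+ 2 * x ^+ 4 / (4 * N ^+ 2) + (1 + d) * x ^+ 2 * B / N)
  <= alpha.
Proof.
move=> N0 x0 lo0 zx lod d0 dhi /andP[B0 B1] r00 rN a1 num.
have N_ge0 := ltW N0; have x_ge0 := ltW x0.
have d1 : 0 < 1 + d by rewrite ltr_wpDr.
have hi0 : 0 <= hi by apply: le_trans dhi; apply: ltW.
pose r := x ^+ 2 / N.
have r0r : r0 <= r by rewrite /r ler_pdivlMr.
have rpos : 0 < r by apply: lt_le_trans r0r.
have r_ge0 := ltW rpos.
set m := _ / (2 * N); set W := (X in 1 - _ / X).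
have mE : lo ^+ 3 * r / 2 <= m.
  have -> : m = (1 - d) * (z ^+ 2 / N) / 2.
    by rewrite /m; field; rewrite gt_eqF.
  have zz : lo ^+ 2 * r <= z ^+ 2 / N.
    rewrite /r mulrA ler_pM2r ?invr_gt0 // -exprMn lerXn2r ?nnegrE //.
      exact: mulr_ge0.
    by apply: le_trans zx; exact: mulr_ge0.
  rewrite exprS -[lo * _ * r]mulrA ler_pM2r ?invr_gt0 //; apply: ler_pM => //.
  by apply: mulr_ge0 => //; apply: exprn_ge0.
have WE : W <= hi ^+ 2 * r ^+ 2 / 4 + hi * r * Bmax.
  have -> : W = (1 + d) ^+ 2 * (r ^+ 2 / 4) + (1 + d) * (r * B).
    by rewrite /W /r; field; rewrite gt_eqF.
  have d1_ge0 := ltW d1.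
  apply: lerD.
    rewrite -[leRHS]mulrA; apply: ler_wpM2r.
      by apply: divr_ge0 => //; apply: exprn_ge0.
    by rewrite lerXn2r ?nnegrE.
  rewrite -[leRHS]mulrA; apply: ler_pM => //; first exact: mulr_ge0.
  by rewrite ler_pM2l.
have W0 : 0 < W.
  apply: ltr_wpDr.
    apply: divr_ge0 => //; apply: mulr_ge0 => //; apply: mulr_ge0.
      exact: ltW.
    exact: exprn_ge0.
  by apply: divr_gt0; apply: mulr_gt0 => //; apply: exprn_gt0.
have a0 : 0 <= 1 - alpha by rewrite subr_ge0.
rewrite lerBlDr addrC -lerBlDr ler_pdivlMr //.
apply: le_trans (ler_wpM2l a0 WE) _.
apply: (@le_trans _ _ ((lo ^+ 3 * r / 2) ^+ 2)); last first.
  have l0 : 0 <= lo ^+ 3 * r / 2.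
    by apply: divr_ge0 => //; apply: mulr_ge0 => //; exact: exprn_ge0.
  by rewrite lerXn2r ?nnegrE // (le_trans l0 mE).
have -> : (1 - alpha) * (hi ^+ 2 * r ^+ 2 / 4 + hi * r * Bmax)
  = r * ((1 - alpha) * (hi ^+ 2 / 4 * r + hi * Bmax)) by ring.
have -> : (lo ^+ 3 * r / 2) ^+ 2 = r * (lo ^+ 6 / 4 * r) :> R by field.
rewrite ler_pM2l //.
have Bm0 : 0 <= (1 - alpha) * (hi * Bmax).
  by rewrite !mulr_ge0 // (le_trans B0).
rewrite [X in X + _ * Bmax]mulrAC [leRHS]mulrAC in num *.
move: (hi ^+ 2) (lo ^+ 6) (hi * Bmax) num Bm0 => u v w num Bm0.
have slope : (1 - alpha) * u <= v.
  by rewrite -(ler_pM2r r00); lra.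
have := ler_wpM2r (_ : 0 <= r - r0) slope; rewrite subr_ge0 => /(_ r0r).
lra.
Qed.

End Numerics.

(** N is so large that the mixing time T is at most 2^(q/2), with q at most a quarter
    of log N.  Then layers with up to 2q squarings fit below N, and the
    deeper ones are negligible. *)
Definition log_scale (N q : nat) : Prop :=
  [/\ (6 <= q)%N, (4 * q <= up_log 2 N)%N
    & (24 * mixing_time (up_log 2 N) ^ 2 <= 2 ^ q)%N].

Lemma log_scale_exists : exists N0 : nat, forall N : nat, (N0 <= N)%N ->
  exists q, log_scale N q.
Proof.
have [c hc] : exists c, forall L, (0 < L)%N -> (mixing_time L <= c * L ^ 4)%N.
  by exists 864; apply: mixing_time_le.
have [q0 hq] := poly_le_exp2 (24 * (c * 5 ^ 4) ^ 2)%N 8.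
(* 24 T^2 is a polynomial of degree 8 in log N, and q is about log N / 4 *)
exists (2 ^ (4 * maxn q0 6))%N => N leN; set L := up_log 2 N.
exists (L %/ 4)%N; set q := (L %/ 4)%N.
have leL : (4 * maxn q0 6 <= L)%N.
  by rewrite -(@leq_exp2l 2) //; apply: leq_trans leN _; apply: up_logP.
have qmax : (maxn q0 6 <= q)%N by rewrite /q leq_divRL // mulnC.
have q6 : (6 <= q)%N by apply: leq_trans qmax; apply: leq_maxr.
split=> //; first by rewrite mulnC leq_divM.
apply: leq_trans (hq q (leq_trans (leq_maxl _ _) qmax)).
have Lq : (L <= 5 * q)%N.
  have := divn_eq L 4; have := ltn_pmod L (isT : (0 < 4)%N).
  by rewrite -/q; move: (L %% 4)%N => r; lia.
have L0 : (0 < L)%N by apply: leq_trans leL; rewrite muln_gt0 leq_max orbT.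
rewrite -mulnA leq_mul2l /=.
rewrite (_ : ((c * 5 ^ 4) ^ 2 * q ^ 8 = (c * (5 * q) ^ 4) ^ 2)%N); last first.
  by rewrite [((5 * q) ^ 4)%N]expnMn mulnA [RHS]expnMn -(expnM q 4 2).
rewrite leq_exp2r //; apply: leq_trans (hc L L0) _.
by rewrite leq_mul2l leq_exp2r // Lq orbT.
Qed.

Section LogScale.
Variables (R : rcfType) (N q : nat).
Hypothesis scale : log_scale N q.
Notation L := (up_log 2 N).
Notation T := (mixing_time L).

Lemma log_scale_log_gt0 : (0 < L)%N.
Proof. by case: scale => q6 qL _; apply: leq_trans qL; lia. Qed.

Lemma log_scale_mixing_gt0 : (0 < T)%N.
Proof. by rewrite /mixing_time !muln_gt0 /= !log_scale_log_gt0. Qed.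

Let exp_le_N k : (k < L)%N -> (2 ^ k <= N)%N.
Proof.
move=> kL; apply: ltnW; have N1 : (1 < N)%N.
  by have := log_scale_log_gt0; rewrite up_log_gt0 => /andP[].
apply: leq_ltn_trans (up_log_gtn (isT : (1 < 2)%N) N1).
by rewrite leq_exp2l //; lia.
Qed.

Lemma log_scale_layers : (T * 2 ^ (2 * q) <= N)%N.
Proof.
have [q6 qL Tq] := scale.
have Tle : (T <= 2 ^ q)%N by apply: leq_trans Tq; rewrite expnS expn1; nia.
apply: (@leq_trans (2 ^ (3 * q))%N); last by apply: exp_le_N; lia.
by rewrite (_ : 3 * q = q + 2 * q)%N ?expnD ?leq_mul2r ?Tle ?orbT //; lia.
Qed.

Let mixing_sqr_le : 24 * T%:R ^+ 2 <= 2 ^+ q :> R.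
Proof. by have [_ _] := scale; rewrite -!natrX -natrM ler_nat. Qed.

Let card_large : 1000 * 2 ^+ q <= N%:R :> R.
Proof.
have [q6 qL _] := scale.
rewrite -natrX -natrM ler_nat; apply: leq_trans (exp_le_N (k := q + 10) _).
  by rewrite expnD mulnC leq_mul2l orbC.
lia.
Qed.

Lemma log_scale_card : 1000 <= N%:R :> R.
Proof.
apply: le_trans card_large.
by rewrite ler_pMr // exprn_ege1 // ler1n.
Qed.

Lemma log_scale_mixing_sqrt : 100 * T%:R <= Num.sqrt N%:R :> R.
Proof.
rewrite -ler_sqr ?nnegrE ?mulr_ge0 ?sqrtr_ge0 // sqr_sqrtr ?ler0n //.
apply: le_trans card_large; move: mixing_sqr_le.
by move: (2 ^+ q) (T%:R) => a b; nra.
Qed.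

Lemma log_scale_kappa : kappa_bound R T (2 * q) <= 90 + 1 / 4.
Proof.
rewrite /kappa_bound lerD2l.
(* (2/3)^2 <= 1/2 *)
have pq : (2 / 3) ^+ (2 * q) <= (2 ^+ q)^-1 :> R.
  rewrite exprM -exprVn lerXn2r ?nnegrE ?exprn_ge0 ?invr_ge0 //; last by lra.
  by rewrite divr_ge0.
apply: (@le_trans _ _ (6 * T%:R ^+ 2 * (2 ^+ q)^-1)).
  by rewrite ler_wpM2l // mulr_ge0 ?exprn_ge0.
rewrite ler_pdivrMr ?exprn_gt0 //; move: mixing_sqr_le.
by move: (2 ^+ q) (T%:R ^+ 2) => a b; lra.
Qed.

End LogScale.

(** The relative errors in the second moment bound are at most 1/1000, and the
    near pairs contribute 2 kappa = 180 with a margin of 2. *)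
Lemma walk_numeric (R : realFieldType) (N s t n kap : R) :
  s ^+ 2 = N -> 0 < s -> 1000 <= N -> 0 <= t -> 100 * t <= s ->
  24 * s <= n <= 50 * s -> kap <= 90 + 1 / 4 ->
  [/\ 999 / 1000 * n <= n - 2 * t, 999 / 1000 <= 1 - N^-1,
      1 + N^-1 <= 1001 / 1000
    & 2 * (kap + (1 + N^-1) / N * t * n) <= 182].
Proof.
move=> sN s0 N1000 t0 ts /andP[n_lo n_hi] kap_le.
have N0 : 0 < N by rewrite -sN exprn_gt0.
have inv_small : N^-1 <= 1 / 1000 by rewrite div1r lef_pV2 ?posrE.
have inv_ge0 : 0 <= N^-1 by rewrite invr_ge0 ltW.
split; try lra.
have tn : t * n <= s / 100 * (50 * s) by apply: ler_pM => //; lra.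
have tn0 : 0 <= t * n by apply: mulr_ge0 => //; lra.
have near : (1 + N^-1) / N * t * n <= 1 / 2 + 1 / 1000.
  rewrite -mulrA mulrAC ler_pdivrMr //.
  apply: (@le_trans _ _ ((1 + 1 / 1000) * (s / 100 * (50 * s)))).
    by apply: ler_pM => //; lra.
  by rewrite -sN expr2; lra.
lra.
Qed.

Lemma rho_survival_le (R : rcfType) (gT : finGroupType) (g h y : gT) q n
    (r0 alpha : R) (s := Num.sqrt #|gT|%:R : R) :
  odd #|gT| -> generator [set: gT] g -> log_scale #|gT| q ->
  24 * s <= n%:R <= 50 * s -> 0 < r0 -> r0 * s ^+ 2 <= n%:R ^+ 2 ->
  alpha <= 1 ->
  (1 - alpha) * ((1001 / 1000) ^+ 2 * r0 / 4 + 1001 / 1000 * 182)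
    <= (999 / 1000) ^+ 6 * r0 / 4 ->
  survival R (rho_map g h) n y <= alpha.
Proof.
move=> odd_G gen_g scale n_range r00 rn a1 num.
pose T := mixing_time (up_log 2 #|gT|).
have A_gt0 : (0 < #|'I_3|)%N by rewrite card_ord.
have L_gt0 := log_scale_log_gt0 scale.
have T_gt0 := log_scale_mixing_gt0 scale.
have fit := log_scale_layers scale.
have N1000 := log_scale_card R scale.
have N0 : 0 < #|gT|%:R :> R by apply: lt_le_trans N1000.
have s_gt0 : 0 < s by rewrite sqrtr_gt0.
have sN : s ^+ 2 = #|gT|%:R by rewrite sqr_sqrtr // ltW.
have [zx lo_le hi_ge B_le] := walk_numeric sN s_gt0 N1000 (ler0n R T)
  (log_scale_mixing_sqrt R scale) n_range (log_scale_kappa R scale).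
have n0R : 0 < n%:R :> R.
  by case/andP: n_range => + _; apply: lt_le_trans; rewrite mulr_gt0.
have n0 : (0 < n)%N by rewrite -(ltr0n R).
have inv_ge0 : 0 <= #|gT|%:R^-1 :> R by rewrite invr_ge0 ltW.
have inv_le1 : #|gT|%:R^-1 <= 1 :> R.
  by rewrite invf_le1 //; apply: le_trans N1000; rewrite ler1n.
have mix := rho_mixes h odd_G gen_g L_gt0 (up_logP #|gT| (isT : (1 < 2)%N)).
have := survival_second_moment A_gt0 (fun c => @rho_map_inj gT g h c odd_G)
  T_gt0 inv_ge0 (mix R)
  (fun u => green_returns R h odd_G gen_g u fit)
  (fun u => green_meets R h odd_G gen_g u fit) y inv_le1 n0.
move/le_trans; apply; rewrite /second_moment_bound.
have B0 : 0 <= near_bound gT T #|gT|%:R^-1 (kappa_bound R T (2 * q)) n.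
  exact: (near_bound_ge0 A_gt0 inv_ge0
    (fun u => green_returns R h odd_G gen_g u fit) y).
rewrite sN in rn.
apply: (second_moment_numeric _ _ _ _ lo_le inv_ge0 hi_ge _ r00 rn a1 num) => //.
- by rewrite divr_ge0.
- apply: le_trans zx _.
  by rewrite lerBlDr -natrM -natrD ler_nat addnC -leq_subLR.
by rewrite B0.
Qed.

Lemma sqrt19_bounds (R : rcfType) :
  87 / 20 <= Num.sqrt 19 :> R /\ Num.sqrt 19 < 35 / 8 :> R.
Proof.
have s0 : 0 <= Num.sqrt 19 :> R by apply: sqrtr_ge0.
have e : Num.sqrt 19 ^+ 2 = 19 :> R by rewrite sqr_sqrtr.
move: (Num.sqrt 19) s0 e => x x0 e; split; nra.
Qed.

Lemma block_range (R : realFieldType) (s l : R) :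
  30 <= s -> 24 * s <= l <= 24 * s + 1 ->
  [/\ 24 * s <= l <= 50 * s, 24 * s <= l + l <= 50 * s,
      576 * s ^+ 2 <= l ^+ 2 & 2304 * s ^+ 2 <= (l + l) ^+ 2].
Proof.
move=> s30 /andP[l1 l2].
by split; [apply/andP; split; lra | apply/andP; split; lra | nra | nra].
Qed.

Lemma block_mean_le (R : realFieldType) (s l x : R) :
  30 <= s -> l <= 24 * s + 1 -> 87 / 20 <= x ->
  l * (1 + 29 / 50) / (1 - 13 / 50) <= 12 * x * s.
Proof.
move=> s30 l2 x_lo; rewrite ler_pdivrMr; last by lra.
have : 87 / 20 * s <= x * s by rewrite ler_wpM2r //; lra.
by move: (x * s) (mulrA 12 x s) => xs <-; lra.
Qed.

(** The survival bounds at l and 2l, where l is 24 sqrt N rounded up, correspond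
    to n^2 / N at least 576 and 2304.  Ideally 1 / (1 + n^2 / (720 N)) would
    give 5/9 and 5/21; 29/50 and 13/50 leave room for the errors. *)
Lemma rho_mean_le (R : realType) (gT : finGroupType) (g h y : gT) q
    (s := Num.sqrt #|gT|%:R : R) :
  odd #|gT| -> generator [set: gT] g -> log_scale #|gT| q ->
  expected_collision_time R g h y <= 12 * Num.sqrt 19 * s.
Proof.
move=> odd_G gen_g scale.
have N1000 := log_scale_card R scale.
have N0 : 0 < #|gT|%:R :> R by apply: lt_le_trans N1000.
have s0 : 0 < s by rewrite sqrtr_gt0.
have s30 : 30 <= s.
  rewrite -ler_sqr ?nnegrE ?(ltW s0) // sqr_sqrtr ?(ltW N0) //.
  by apply: le_trans N1000; rewrite -natrX ler_nat.
pose l := (Num.truncn (24 * s)).+1.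
have /truncn_itv/andP[l_le l_gt] : 0 <= 24 * s by rewrite mulr_ge0 // ltW.
have l_range : 24 * s <= l%:R <= 24 * s + 1.
  by rewrite (ltW l_gt) /l -natr1 lerD2r.
have [r1 r2 sq1 sq2] := block_range s30 l_range.
have surv := rho_survival_le h _ odd_G gen_g scale.
have h1 v : survival R (rho_map g h) l v <= 29 / 50.
  by apply: surv r1 _ sq1 _ _ => //; clear; lra.
have h2 v : survival R (rho_map g h) (l + l) v <= 13 / 50.
  rewrite -natrD in r2 sq2.
  by apply: surv r2 _ sq2 _ _ => //; clear; lra.
have Nle : (#|gT| <= #|gT| * (l + l))%N by rewrite leq_pmulr // addn_gt0.
apply: le_trans (expected_collision_time_le R g h y Nle) _.
apply: le_trans (sum_survival _ _ _ _ h1 h2) _; first by rewrite card_ord.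
  by clear; lra.
have [lo19 _] := sqrt19_bounds R.
by case/andP: l_range => _ l2; apply: block_mean_le.
Qed.

Theorem theorem4p2 (R : realType) (eps : R) (heps : 0 < eps) :
  exists N0 : nat, forall (G : finGroupType) (g h y0 : G),
    odd #|G| -> (N0 <= #|G|)%N -> generator [set: G] g ->
    expected_collision_time R g h y0
      <= (1 + eps) * (12%:R * Num.sqrt 19%:R) * Num.sqrt #|G|%:R
      < (1 + eps) * (105%:R / 2%:R) * Num.sqrt #|G|%:R.
Proof.
have [N0 hN0] := log_scale_exists.
exists N0 => G g h y0 odd_G /hN0[q scale] gen_g.
have [lo19 hi19] := sqrt19_bounds R.
have s0 : 0 < Num.sqrt #|G|%:R :> R.
  by rewrite sqrtr_gt0 ltr0n; apply/card_gt0P; exists g.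
have e1 : 0 < 1 + eps by rewrite addr_gt0.
apply/andP; split.
  apply: le_trans (rho_mean_le R h y0 odd_G gen_g scale) _.
  rewrite ler_pM2r // ler_peMl //; first by rewrite mulr_ge0 ?sqrtr_ge0.
  by rewrite lerDl ltW.
by rewrite ltr_pM2r // ltr_pM2l //; move: hi19; clear; lra.
Qed.
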